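(* Let $K$ be a field. For a simple graph $G$ on a vertex set $[N]=\{1,\dots,N\}$ let $R_G=S/P_G$, where $S=K[x_{ij}:1\le i,j\le N]$ and $P_G$ is the ideal of $S$ generated by the binomials $x_{ii}x_{jj}-x_{ij}x_{ji}$ with $\{i,j\}$ an edge of $G$, $i<j$. If $G$ is the cycle with $m\ge 3$ edges, then $\operatorname{rank}\operatorname{Cl}(R_G)=2m$. Moreover, for each positive integer $n$ there exists a simple graph $G$ such that $\operatorname{Cl}(R_G)$ is a free abelian group of rank $n$.
   Context: $S$ is the polynomial ring over $K$ in the $N^2$ variables $x_{ij}$, $1\le i,j\le N$. The ring $R_G$ is a normal Noetherian domain, and $\operatorname{Cl}(R_G)$ denotes its divisor class group. *)

(* Defs.v *)
From HB Require Import structures.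
From mathcomp Require Import all_boot all_order all_algebra ring_quotient.
From mathcomp Require Import boolp.
From mathcomp Require Import freeg mpoly.

Set Implicit Arguments.
Unset Strict Implicit.
Unset Printing Implicit Defensive.

Import GRing.Theory.
Local Open Scope ring_scope.

(* Subsets of a ring are boolean predicates, as in ring_quotient; by function  *)
(* extensionality, predicates with the same elements are equal.                *)

Section ClassGroup.
Variable A : comNzRingType.
Implicit Types (P Q : pred A) (a : A) (n : nat).

(* idealr_closed includes 1 \notin P. *)
Definition is_prime_ideal P := idealr_closed P /\ prime_idealr_closed P.

Definition prime_chain P n := exists Q : nat -> pred A,
  [/\ forall i, (i <= n)%N -> is_prime_ideal (Q i),
      forall i, (i < n)%N ->
        {subset Q i <= Q i.+1} /\ exists2 x, x \in Q i.+1 & x \notin Q i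
    & Q n = P].

Definition has_height P n :=
  [/\ is_prime_ideal P, prime_chain P n
    & forall n', prime_chain P n' -> (n' <= n)%N].

Definition height_one : pred (pred A) := fun P => `[< has_height P 1 >].

Definition prime_divisor := {P : pred A | height_one P}.

(* a belongs to the ideal P^n generated by the n-fold products in P. *)
Definition in_ideal_pow P n a := exists s : seq (A * n.-tuple A),
  (forall ct : A * n.-tuple A, ct \in s -> all P ct.2)
  /\ a = \sum_(ct <- s) ct.1 * \prod_(x <- ct.2) x.

(* The image of a in the localization A_P belongs to P^n A_P. *)
Definition in_local_pow P n a :=
  exists2 s : A, s \notin P & in_ideal_pow P n (s * a).

(* v_P(a) = n. When A_P is a discrete valuation ring, this is its normalized   *)
(* valuation, the powers of its maximal ideal being the P^n A_P.               *)
Definition has_valuation P a n := in_local_pow P n a /\ ~ in_local_pow P n.+1 a.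

Definition weil_divisor := {freeg prime_divisor}.

Definition is_div a (D : weil_divisor) := forall P : prime_divisor,
  exists2 n : nat, has_valuation (val P) a n & coeff P D = n%:Z.

(* The subgroup generated by the div(a), a != 0. When A is a normal Noetherian *)
(* domain, its elements are the div(f) = div(a) - div(b), with f = a / b a     *)
(* nonzero element of the fraction field.                                      *)
Definition principal (D : weil_divisor) : bool :=
  `[< exists s : seq (int * weil_divisor),
        (forall cE : int * weil_divisor,
           cE \in s -> exists2 a : A, a != 0 & is_div a cE.2)
        /\ D = \sum_(cE <- s) cE.2 *~ cE.1 >].

Lemma principal_zmod_closed : zmod_closed principal.
Proof.
split=> [|D E /asboolP[s [hs ->]] /asboolP[t [ht ->]]].
  by apply/asboolP; exists [::]; split=> //; rewrite big_nil.
apply/asboolP; exists (s ++ [seq (- cE.1, cE.2) | cE <- t]); split.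
  move=> cE; rewrite mem_cat => /orP[/hs //|/mapP[dE /ht h ->]] //.
rewrite big_cat big_map /=; congr (_ + _).
by rewrite -sumrN; apply: eq_bigr => cE _; rewrite mulrNz.
Qed.
HB.instance Definition _ :=
  GRing.isZmodClosed.Build weil_divisor principal principal_zmod_closed.

Definition Cl : zmodType :=
  Quotient.quot (GRing.ZmodClosed.clone weil_divisor principal _).

End ClassGroup.

Section AbelianGroups.
Variable M : zmodType.

Definition Zindependent n (v : 'I_n -> M) :=
  forall c : 'I_n -> int, \sum_i v i *~ c i = 0 -> forall i, c i = 0.

Definition Zspanning n (v : 'I_n -> M) :=
  forall x : M, exists c : 'I_n -> int, x = \sum_i v i *~ c i.

Definition has_rank n :=
  (exists v : 'I_n -> M, Zindependent v)
  /\ forall n' (v : 'I_n' -> M), Zindependent v -> (n' <= n)%N.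

Definition free_of_rank n :=
  exists v : 'I_n -> M, Zindependent v /\ Zspanning v.

End AbelianGroups.

(* The vertex set [N] is represented by 'I_N = {0, ..., N-1}. *)
Record simple_graph N := SimpleGraph {
  adj :> rel 'I_N;
  adj_sym : ssrbool.symmetric adj;
  adj_irr : irreflexive adj
}.

(* ordS is the successor modulo m; for m >= 3 the right-hand side is the       *)
(* adjacency relation of the m-cycle.                                          *)
Definition is_cycle N (G : simple_graph N) m :=
  exists2 f : 'I_m -> 'I_N, bijective f &
    forall i j, G (f i) (f j) = (j == ordS i) || (i == ordS j).

Section GraphRing.
Variables (K : fieldType) (N : nat) (G : simple_graph N).

Local Notation S := {mpoly K[N * N]}.

Definition xvar (i j : 'I_N) : S := 'X_(mxvec_index i j).

Definition edge_binomial (ij : 'I_N * 'I_N) : S :=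
  xvar ij.1 ij.1 * xvar ij.2 ij.2 - xvar ij.1 ij.2 * xvar ij.2 ij.1.

Definition graph_ideal (f : S) : bool :=
  `[< exists c : 'I_N * 'I_N -> S,
        f = \sum_(ij : 'I_N * 'I_N | (ij.1 < ij.2)%N && G ij.1 ij.2)
              c ij * edge_binomial ij >].

Lemma graph_ideal_closed : idealr_closed graph_ideal.
Proof.
split.
- apply/asboolP; exists (fun=> 0); rewrite big1 // => ij _; exact: mul0r.
- apply/negP => /asboolP[c /(congr1 (meval (fun=> 0)))].
  rewrite rmorph1 rmorph_sum big1 => [/eqP|ij _]; first by rewrite oner_eq0.
  by rewrite rmorphM rmorphB !rmorphM /= !mevalXU !mul0r subrr mulr0.
- move=> a f g /asboolP[c ->] /asboolP[d ->]; apply/asboolP.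
  exists (fun ij => a * c ij + d ij).
  by rewrite mulr_sumr -big_split /=; apply: eq_bigr => ij _; rewrite mulrDl mulrA.
Qed.
HB.instance Definition _ := isIdealr.Build S graph_ideal graph_ideal_closed.

Definition graph_ring : comNzRingType :=
  {ideal_quot (Idealr.clone S graph_ideal _)}.

End GraphRing.

(* Main.v *)
Require Import Defs.
From mathcomp Require Import all_boot all_order all_algebra.
From HB Require Import structures.
From mathcomp Require Import ring_quotient boolp freeg mpoly zify.

Set Implicit Arguments.
Unset Strict Implicit.
Unset Printing Implicit Defensive.

Import Order.TTheory GRing.Theory Num.Theory.

(* R_G is embedded in a polynomial ring C (its Cox ring) with one variable t_x  *)
(* for each height one monomial prime x: the variable x_ij is sent to the       *)
(* product of the t_x such that x contains x_ij. The image is the degree zero   *)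
(* part of C for a grading by Z^b. Since C is factorial, every nonzero          *)
(* homogeneous element of C is a product of homogeneous primes p; the ideals    *)
(* pC \cap R_G are exactly the height one primes of R_G, their valuations are   *)
(* the multiplicities of the p, and D |-> deg(prod p^(n_p)) identifies the      *)
(* class group with Z^b. Besides the free variables x_ij, ij not an edge, the    *)
(* monomial primes are indexed by the pairs (k, e) with e a set of neighbours   *)
(* of k, whence b = \sum_k 2^(deg k) - N - #|edges|.                            *)
(* This is 2m for the m-cycle, and n for n disjoint edges.                      *)

(** The proof rests on two facts and a count.

    Let C be a polynomial ring graded by Z^b in which every degree is attained by a monomial
    avoiding any prescribed variable. Then Cl(C_0) is Z^b ([Cl_graded_subring]). Indeed C is
    factorial ([factorial_mpoly]) and factors of homogeneous elements are homogeneous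
    ([homog_factorl]). A homogeneous prime times a monomial of opposite degree, chosen not divisible
    by it, lies in C_0. This matches homogeneous primes, up to units, with height one primes
    ([contraction_height_one], [height_one_contraction]) and multiplicities with valuations
    ([in_local_powP]). A divisor is then principal exactly when its degree is zero ([principalP]).

    The ring R_G is such a C_0 ([Cl_graph_ring]). Modulo P_G, each product x_ij x_ji over an edge
    can be replaced by x_ii x_jj until one of x_ij, x_ji is absent. This normal form depends only on
    the valuations of the monomial along the monomial primes, so the map from S to C has kernel P_G
    ([graph_pi_normal], [cox_map_ker]). Every degree zero vector of valuations comes from a normal
    monomial, so the image is C_0 ([facet_exp_normal], [cox_embedding_onto]).

    Finally b is the number of edges plus the number of pairs of a vertex and a set of at least two
    of its neighbours ([card_basic]): m + m for the m-cycle, and n + 0 for n disjoint edges. *)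

(** * Factorial domains *)

Section Factorial.
Local Open Scope ring_scope.
Variable R : idomainType.
Implicit Types (a b c p q u : R) (s : seq R).

Definition rdivides a b := exists c, b = c * a.

Definition prime_elt p :=
  [/\ p != 0, p \isn't a GRing.unit
    & forall a b, rdivides p (a * b) -> rdivides p a \/ rdivides p b].

Definition factors_as a u s :=
  [/\ u \is a GRing.unit, forall p, p \in s -> prime_elt p
    & a = u * \prod_(p <- s) p].

Definition factors a := exists u s, factors_as a u s.

Lemma rdivides_refl a : rdivides a a.
Proof. by exists 1; rewrite mul1r. Qed.

Lemma rdivides_trans b a c : rdivides a b -> rdivides b c -> rdivides a c.
Proof. by move=> [x ->] [y ->]; exists (y * x); rewrite mulrA. Qed.

Lemma rdivides_mull a b c : rdivides a b -> rdivides a (c * b).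
Proof. by move=> [x ->]; exists (c * x); rewrite mulrA. Qed.

Lemma rdivides_mulr a b c : rdivides a b -> rdivides a (b * c).
Proof. by rewrite mulrC; exact: rdivides_mull. Qed.

Lemma rdividesD a b c : rdivides a b -> rdivides a c -> rdivides a (b + c).
Proof. by move=> [x ->] [y ->]; exists (x + y); rewrite mulrDl. Qed.

Lemma rdividesB a b c : rdivides a b -> rdivides a c -> rdivides a (b - c).
Proof. by move=> [x ->] [y ->]; exists (x - y); rewrite mulrBl. Qed.

Lemma rdivides0 a : rdivides a 0.
Proof. by exists 0; rewrite mul0r. Qed.

Lemma rdivides_sum (I : Type) (r : seq I) (P : pred I) (F : I -> R) a :
  (forall i, P i -> rdivides a (F i)) -> rdivides a (\sum_(i <- r | P i) F i).
Proof.
by move=> h; apply: big_ind => //; [exact: rdivides0 | exact: rdividesD].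
Qed.

Lemma rdivides_unit a u :
  rdivides a u -> u \is a GRing.unit -> a \is a GRing.unit.
Proof. by move=> [c ->]; rewrite unitrM => /andP[]. Qed.

Lemma rdivides_antisym a b : a != 0 -> rdivides a b -> rdivides b a ->
  exists2 u, u \is a GRing.unit & b = u * a.
Proof.
move=> a0 [c ->] [d]; rewrite mulrA -{1}[a]mul1r => /(mulIf a0) dc.
by exists c => //; apply/unitrP; exists d; rewrite [c * d]mulrC -dc.
Qed.

Lemma prime_elt_neq0 p : prime_elt p -> p != 0.
Proof. by case. Qed.

Lemma prime_elt_dvd p q : prime_elt p -> prime_elt q -> rdivides p q ->
  rdivides q p.
Proof.
move=> [p0 pN _] [q0 _ qP] [c qE].
have /qP[[d dE]|//] : rdivides q (c * p) by rewrite -qE; exact: rdivides_refl.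
case/negP: pN; apply/unitrP; exists d.
suff dp : d * p = 1 by rewrite [p * d]mulrC dp.
by apply: (mulIf q0); rewrite mul1r mulrAC -dE.
Qed.

Lemma prime_elt_prod (I : eqType) (r : seq I) (F : I -> R) p : prime_elt p ->
  rdivides p (\prod_(i <- r) F i) -> exists2 i, i \in r & rdivides p (F i).
Proof.
move=> pP; have [_ pN pM] := pP; elim: r => [|i r IHr].
  by rewrite big_nil => /rdivides_unit/(_ (unitr1 _)); rewrite (negPf pN).
rewrite big_cons => /pM[pi|/IHr[j jr pj]].
  by exists i; rewrite ?mem_head.
by exists j; rewrite // inE jr orbT.
Qed.

Lemma factors_unit u : u \is a GRing.unit -> factors u.
Proof. by exists u, [::]; split; rewrite // big_nil mulr1. Qed.

Lemma factors_prime p : prime_elt p -> factors p.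
Proof.
move=> pP; exists 1, [:: p]; split; rewrite ?unitr1 ?mul1r ?big_seq1 //.
by move=> q; rewrite inE => /eqP->.
Qed.

Lemma factorsM a b : factors a -> factors b -> factors (a * b).
Proof.
move=> [u [s [uU sP ->]]] [v [t [vU tP ->]]]; exists (u * v), (s ++ t).
split; rewrite ?unitrM ?uU ?big_cat 1?mulrACA // => p.
by rewrite mem_cat => /orP[/sP|/tP].
Qed.

(** The prime [p] divides some factor, hence is associated to it and cancels against it. The strict
    drop in length is the induction measure of [primitive_part]. *)
Lemma factors_as_cofactor p a u s : prime_elt p -> factors_as (p * a) u s ->
  exists v t, factors_as a v t /\ (size t < size s)%N.
Proof.
move=> pP [uU]; elim: s a => [|q s IHs] a sP.
  rewrite big_nil mulr1 => paE; case: pP => _ /negP[]; move: uU.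
  by rewrite -paE unitrM => /andP[].
have qP : prime_elt q by apply: sP; rewrite mem_head.
have {}sP p' : p' \in s -> prime_elt p' by move=> h; apply: sP; rewrite inE h orbT.
rewrite big_cons mulrCA => paE.
have [_ _ pM] := pP.
have /pM[pq|[c qE]] : rdivides p (q * (u * \prod_(p <- s) p)).
- by rewrite -paE mulrC; exists a.
- have [c cU qE] :=
    rdivides_antisym (prime_elt_neq0 pP) pq (prime_elt_dvd pP qP pq).
  exists (c * u), s; split=> //; split=> //; first by rewrite unitrM cU.
  by apply: (mulfI (prime_elt_neq0 pP)); rewrite paE qE -!mulrA mulrCA.
have /IHs[//|v [t [[vU tP cE] lt_ts]]] : p * c = u * \prod_(p <- s) p.
  by rewrite qE mulrC.
exists v, (q :: t); split; last by rewrite /= ltnS.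
split=> // [p'|]; first by rewrite inE => /orP[/eqP->|/tP].
apply: (mulfI (prime_elt_neq0 pP)); rewrite paE qE big_cons cE.
by rewrite [_ * p]mulrC mulrCA; congr (_ * _); rewrite mulrCA.
Qed.

End Factorial.

Definition factorial_ring (R : idomainType) :=
  forall a : R, (a != 0)%R -> factors a.

(** * Gauss's lemma: polynomials over a factorial domain *)

(* Divisibility %| in {poly R} over a domain is divisibility up to a nonzero    *)
(* constant, hence divisibility over the fraction field of R.                   *)
Section Gauss.
Local Open Scope ring_scope.
Variable R : idomainType.
Implicit Types (f g h : {poly R}) (c p u : R).

Lemma rdivides_polyC p f :
  rdivides p%:P f <-> forall i, rdivides p f`_i.
Proof.
split=> [[g ->] i|h]; first by rewrite coefMC; exists g`_i.
have /choice[c cP] : forall i, exists c, f`_i = c * p by exact: h.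
exists (\poly_(i < size f) c i); apply/polyP=> i.
rewrite coefMC coef_poly; case: ltnP => [_|le_fi]; first exact: cP.
by rewrite mul0r nth_default.
Qed.

(** If [p] divides neither [f] nor [g], take the least indices [i] and [j] of coefficients that it
    does not divide. In the coefficient of degree [i + j] of [f * g], every term other than the
    product of these two is divisible by [p]. *)
Lemma prime_polyC p : prime_elt p -> prime_elt p%:P.
Proof.
move=> [p0 pN pP]; split; first by rewrite polyC_eq0.
  by rewrite poly_unitE size_polyC p0 coefC.
move=> f g pfg; have [pf|/existsNP[i0 i0P]] := pselect (forall i, rdivides p f`_i).
  by left; apply/rdivides_polyC.
have [pg|/existsNP[j0 j0P]] := pselect (forall i, rdivides p g`_i).
  by right; apply/rdivides_polyC.
have exi : exists i, ~~ `[< rdivides p f`_i >] by exists i0; apply/asboolPn.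
have exj : exists j, ~~ `[< rdivides p g`_j >] by exists j0; apply/asboolPn.
case: (ex_minnP exi) => i /asboolPn iP imin.
case: (ex_minnP exj) => j /asboolPn jP jmin.
have lti k : (k < i)%N -> rdivides p f`_k.
  by move=> ki; apply: contrapT => nk; have := imin k;
    rewrite leqNgt ki => /(_ (introT (asboolPn _) nk)).
have ltj k : (k < j)%N -> rdivides p g`_k.
  by move=> kj; apply: contrapT => nk; have := jmin k;
    rewrite leqNgt kj => /(_ (introT (asboolPn _) nk)).
case: (pP f`_i g`_j) => //.
have lt_i : (i < (i + j).+1)%N by rewrite ltnS leq_addr.
have := (rdivides_polyC p (f * g)).1 pfg (i + j)%N.
rewrite coefM (bigD1 (Ordinal lt_i)) //= addKn => h.
rewrite -[X in rdivides p X](addrK (\sum_(k < (i + j).+1 | k != Ordinal lt_i)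
  f`_k * g`_(i + j - k))).
apply: rdividesB h _; apply: rdivides_sum => k; rewrite -val_eqE /= => ki.
have [lt_ki|le_ik] := ltnP k i; first exact: rdivides_mulr (lti _ lt_ki).
apply: rdivides_mull; apply: ltj.
have lt_ik : (i < k)%N by rewrite ltn_neqAle eq_sym ki.
by rewrite ltn_subLR ?ltn_add2r // -ltnS ltn_ord.
Qed.

Definition primitive f := forall p, prime_elt p -> ~ rdivides p%:P f.

Hypothesis factR : factorial_ring R.

(** Dividing out a prime constant shortens a factorization of the leading coefficient, so the
    process stops. *)
Lemma primitive_part f : f != 0 ->
  exists c g, [/\ c != 0, primitive g & f = c *: g].
Proof.
move=> f0; have /factR[u [s fs]] : lead_coef f != 0 by rewrite lead_coef_eq0.
have [n] := ubnP (size s); elim: n => // n IHn in f f0 u s fs *.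
rewrite ltnS => le_sn; have [fP|nfP] := pselect (primitive f).
  by exists 1, f; rewrite oner_eq0 scale1r.
have [p pP [g fE]] : exists2 p, prime_elt p & rdivides p%:P f.
  by apply: contrapT => np; apply: nfP => p pP pf; apply: np; exists p.
have g0 : g != 0 by apply: contraNneq f0 => g0; rewrite fE g0 mul0r.
have pE : lead_coef f = p * lead_coef g.
  by rewrite fE lead_coefM lead_coefC mulrC.
rewrite pE in fs; have [v [t [gt lt_ts]]] := factors_as_cofactor pP fs.
have [c [h [c0 hP gE]]] := IHn g g0 v t gt (leq_trans lt_ts le_sn).
exists (c * p), h; rewrite mulf_neq0 ?(prime_elt_neq0 pP) //; split=> //.
by rewrite fE gE mulrC mul_polyC scalerA mulrC.
Qed.

Lemma scale_prime_eqM p f g h : prime_elt p -> p *: f = g * h ->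
  (exists2 g', g = p *: g' & f = g' * h) \/ (exists2 h', h = p *: h' & f = g * h').
Proof.
move=> pP e; have p0 := prime_elt_neq0 pP; have [_ _ pM] := prime_polyC pP.
have pI : injective (fun f : {poly R} => p *: f).
  by move=> x y /=; rewrite -!mul_polyC; apply: mulfI; rewrite polyC_eq0.
have /pM[[g' gE]|[h' hE]] : rdivides p%:P (g * h).
- by rewrite -e -mul_polyC mulrC; exists f.
- left; exists g'; first by rewrite gE mulrC mul_polyC.
  by apply: pI; rewrite /= e gE -mul_polyC mulrCA mulrA.
- right; exists h'; first by rewrite hE mulrC mul_polyC.
  by apply: pI; rewrite /= e hE -mul_polyC [RHS]mulrC mulrA.
Qed.

(** The primes of [c] are cancelled one by one; by [scale_prime_eqM] each comes off [h] or [f], and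
    the primitive [f] offers none. This turns divisibility over the fraction field into divisibility
    in [{poly R}]. *)
Lemma primitive_rdivides f g h c : primitive f -> c != 0 -> c *: g = h * f ->
  rdivides f g.
Proof.
move=> fP /factR[u [s [uU sP ->]]]; elim: s => [|p s IHs] in g h sP *.
  rewrite big_nil mulr1 => e; exists (u^-1 *: h).
  by rewrite -scalerAl -e scalerA mulVr // scale1r.
have pP : prime_elt p by apply: sP; rewrite mem_head.
have {}sP q : q \in s -> prime_elt q by move=> qs; apply: sP; rewrite inE qs orbT.
rewrite big_cons mulrCA -scalerA => /(scale_prime_eqM pP)[[h' _]|[f' fE]].
  exact: IHs.
by case: (fP p pP); exists f'; rewrite fE mulrC mul_polyC.
Qed.

(** Each prime of [c] is absorbed by one of the two factors without changing its degree. A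
    factorization over the fraction field thus descends to [R]. *)
Lemma scaled_factorization c f g h : c != 0 -> c *: f = g * h ->
  exists g' h', [/\ size g' = size g, size h' = size h & f = g' * h'].
Proof.
move=> /factR[u [s [uU sP ->]]]; elim: s => [|p s IHs] in g h sP *.
  rewrite big_nil mulr1 => e; exists (u^-1 *: g), h; split=> //.
    by rewrite size_scale ?invr_eq0 //; apply: contraTneq uU => ->; rewrite unitr0.
  by rewrite -scalerAl -e scalerA mulVr // scale1r.
have pP : prime_elt p by apply: sP; rewrite mem_head.
have p0 := prime_elt_neq0 pP.
have {}sP q : q \in s -> prime_elt q by move=> qs; apply: sP; rewrite inE qs orbT.
rewrite big_cons mulrCA -scalerA => /(scale_prime_eqM pP)[[g1 -> e]|[h1 -> e]];
  by rewrite size_scale //; apply: IHs.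
Qed.

Lemma prime_primitive f : primitive f -> irreducible_poly f -> prime_elt f.
Proof.
move=> fP [f1 fI]; split.
- by apply: contraTneq f1 => ->; rewrite size_poly0.
- by rewrite poly_unitE negb_and gtn_eqF.
have fdvd g : (f %| g) -> rdivides f g.
  by move=> /Pdiv.Idomain.dvdpP[[c h] /= c0]; apply: primitive_rdivides.
move=> g h [k kE]; have fgh : f %| g * h by rewrite kE dvdp_mull.
have [fg|nfg] := boolP (f %| g); first by left; apply: fdvd.
right; apply: fdvd; rewrite Gauss_dvdpr // in fgh.
rewrite /coprimep; apply: contraNT nfg => /fI/(_ (dvdp_gcdl f g)) e.
by rewrite -(eqp_dvdl _ e) dvdp_gcdr.
Qed.

Lemma factors_polyC c : c != 0 -> factors c%:P.
Proof.
move=> /factR[u [s [uU sP ->]]]; exists u%:P, [seq p%:P | p <- s]; split.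
- by rewrite rmorph_unit.
- by move=> _ /mapP[p /sP pP ->]; apply: prime_polyC.
- by rewrite rmorphM rmorph_prod big_map.
Qed.

(** Induction on the degree. Once the content is split off, a nonconstant primitive polynomial is
    either irreducible over the fraction field, hence prime, or a product of two polynomials of
    smaller degree. *)
Theorem factorial_poly : factorial_ring {poly R}.
Proof.
move=> f; have [n] := ubnP (size f); elim: n f => // n IHn f;
  rewrite ltnS => le_fn f0.
have [c [g [c0 gP fE]]] := primitive_part f0.
have g0 : g != 0 by apply: contraNneq f0 => g0; rewrite fE g0 scaler0.
have sgE : size g = size f by rewrite fE size_scale.
rewrite fE -mul_polyC; apply: factorsM; first exact: factors_polyC.
have [le_g1|lt_1g] := leqP (size g) 1.
  have := size1_polyC le_g1 => gE; rewrite gE; apply: factors_polyC.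
  by rewrite -polyC_eq0 -gE.
have [gI|ngI] := pselect (irreducible_poly g).
  by apply: factors_prime; apply: prime_primitive.
have [h [h1 hg nhg]] : exists h, [/\ size h != 1, h %| g & ~~ (h %= g)].
  apply: contrapT => nh; apply: ngI; split=> // h h1 hg.
  by apply: contrapT => nhg; apply: nh; exists h; split=> //; apply/negP.
have h0 : h != 0 by apply: contraNneq g0 => h0; rewrite -dvd0p -h0.
have lt_hg : (size h < size g)%N.
  by rewrite ltn_neqAle dvdp_leq // andbT dvdp_size_eqp.
have [[d k] /= d0 dgE] := Pdiv.Idomain.dvdpP _ _ hg.
have k0 : k != 0.
  by apply: contraNneq g0 => k0;
    rewrite -size_poly_eq0 -(size_scale g d0) dgE k0 mul0r size_poly0.
have szE : size g = (size k + size h).-1 by rewrite -(size_scale g d0) dgE size_mul.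
have [k' [h' [szk szh ->]]] := scaled_factorization d0 dgE.
have size_h_gt1 : (1 < size h)%N by rewrite ltn_neqAle eq_sym h1 size_poly_gt0.
apply: factorsM; apply: IHn;
  rewrite ?szk ?szh -?size_poly_eq0 ?szk ?szh ?size_poly_eq0 //.
  by move: lt_hg le_fn; rewrite -sgE szE;
    case: (size h) size_h_gt1 => [|[|m]] //= _; rewrite !addnS /= => _;
    apply: leq_trans; rewrite ltnS leq_addr.
by rewrite -sgE in le_fn; exact: leq_trans lt_hg le_fn.
Qed.

End Gauss.

(** * Factoriality of multivariate polynomial rings over a field *)

Section Transfer.
Local Open Scope ring_scope.

Lemma factorial_transfer (R R' : idomainType) (phi : {rmorphism R -> R'}) :
    injective phi -> (forall y, exists x, y = phi x) ->
  factorial_ring R' -> factorial_ring R.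
Proof.
move=> phiI phiS factR' a a0.
have dvdP x y : rdivides (phi x) (phi y) <-> rdivides x y.
  split=> [[c]|[c ->]]; last by exists (phi c); rewrite rmorphM.
  by have [d ->] := phiS c; rewrite -rmorphM => /phiI yE; exists d.
have unitP x : (phi x \is a GRing.unit) = (x \is a GRing.unit).
  apply/idP/idP => [/unitrP[y]|]; last exact: rmorph_unit.
  have [z ->] := phiS y; rewrite -!rmorphM -(rmorph1 phi) => -[/phiI zx /phiI xz].
  by apply/unitrP; exists z.
have primeP x : prime_elt (phi x) -> prime_elt x.
  move=> [x0 xU xM]; split; first by apply: contraNneq x0 => ->; rewrite rmorph0.
    by rewrite -unitP.
  by move=> y z /dvdP; rewrite rmorphM => /xM[]/dvdP; [left|right].
have /factR'[u [s [uU sP aE]]] : phi a != 0.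
  by apply: contraNneq a0 => e; apply/eqP/phiI; rewrite e rmorph0.
have [v vE] := phiS u; have /choice[psi psiE] := phiS.
exists v, (map psi s); split; first by rewrite -unitP -vE.
  by move=> _ /mapP[p /sP pP ->]; apply: primeP; rewrite -psiE.
apply: phiI; rewrite aE rmorphM -vE rmorph_prod big_map; congr (_ * _).
by apply: eq_bigr => p _; rewrite -psiE.
Qed.

Let widenE n (m : 'X_{1..n.+1}) : (mnmwiden [multinom m (widen_ord (leqnSn n) i) |
  i < n] +
  U_(ord_max) *+ m ord_max)%MM = m.
Proof.
apply/mnmP=> i; rewrite mnmDE mulmnE mnm1E.
have [j ->|->] := unliftP ord_max i.
  have -> : fintype.lift ord_max j = widen_ord (leqnSn n) j.
    by apply: val_inj; exact: lift_max.
  rewrite mnmwiden_widen mnmE; case: eqP => [/(congr1 val) /= e|_]; rewrite ?addn0 //.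
  by have := ltn_ord j; rewrite -e ltnn.
by rewrite mnmwiden_ordmax eqxx mul1n.
Qed.

Lemma factorial_mpoly (K : fieldType) n : factorial_ring {mpoly K[n]}.
Proof.
elim: n => [|n IHn].
  move=> p p0; apply: factors_unit; rewrite [p]nvar0_mpolyC rmorph_unit // unitfE.
  by apply: contraNneq p0 => e; rewrite [p]nvar0_mpolyC e.
apply: (@factorial_transfer {mpoly K[n.+1]} {poly {mpoly K[n]}}
  (GRing.RMorphism.clone _ _ (@muni n K) _)) (factorial_poly IHn).
  (* [back] substitutes the last variable for the indeterminate; it is a left inverse of [muni]. *)
  pose back (f : {poly {mpoly K[n]}}) : {mpoly K[n.+1]} :=
    (map_poly (@mwiden n K) f).['X_ord_max].
  apply: (can_inj (g := back)) => p; rewrite /= muniE /back rmorph_sum /= horner_sum.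
  rewrite [RHS]mpolyE; apply: eq_bigr => m _.
  rewrite -mul_polyC rmorphM /= map_polyC map_polyXn /= hornerM hornerC hornerXn.
  by rewrite mwidenZ mwidenX -scalerAl mpolyXn -mpolyXD widenE.
move=> f; exists (\sum_(i < size f) mwiden f`_i * 'X_ord_max ^+ i).
have muniC p : muni (mwiden p) = p%:P.
  rewrite [in LHS](mpolyE p) [in RHS](mpolyE p) [mwiden _]raddf_sum [muni
    _]raddf_sum [RHS]raddf_sum.
  apply: eq_bigr => m _.
  rewrite /= mwidenZ mwidenX muniZ -mul_mpolyC polyCM -mul_polyC; congr (_ * _).
  rewrite muniE msuppX big_seq1 mcoeffX eqxx scale1r mnmwiden_ordmax expr0
    -mul_polyC mulr1.
  by congr (_ _)%:P; apply/mnmP=> i; rewrite mnmE mnmwiden_widen.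
have muniX : muni ('X_ord_max : {mpoly K[n.+1]}) = 'X.
  rewrite muniE msuppX big_seq1 mcoeffX eqxx scale1r mnm1E eqxx expr1.
  rewrite -[RHS]scale1r -mpolyX0; congr ('X_[_] *: _); apply/mnmP=> i.
  by rewrite mnmE mnm1E mnm0E; case: eqP => // /(congr1 val) /= e;
    have := ltn_ord i; rewrite -e ltnn.
rewrite rmorph_sum -{1}[f]coefK poly_def; apply: eq_bigr => i _.
by rewrite /= rmorphM rmorphXn /= muniC muniX mul_polyC.
Qed.

End Transfer.

(** * Recognizing a free abelian quotient *)

Section FreeQuotient.
Local Open Scope ring_scope.

(** Both [pi] and [deg] are onto with the same kernel, so [M] is isomorphic to Z^b; preimages of the
    unit vectors give the basis. *)
Lemma quotient_free_of_rank (V M : zmodType) b (pi : {additive V -> M})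
    (deg : {additive V -> 'rV[int]_b}) :
    (forall y, exists x, y = pi x) -> (forall x, pi x = 0 <-> deg x = 0) ->
    (forall k, exists x, deg x = delta_mx 0 k) ->
  free_of_rank M b.
Proof.
move=> piS piP /choice[e eE].
have degE (c : 'I_b -> int) : deg (\sum_k e k *~ c k) = \row_k c k.
  rewrite raddf_sum; apply/rowP=> l; rewrite summxE (bigD1 l) //= big1 => [|k kl].
    by rewrite raddfMz eE -scaler_int !mxE !eqxx mulr1 addr0 intz.
  by rewrite raddfMz eE -scaler_int !mxE eq_sym (negPf kl) andbF mulr0.
have piE c : \sum_k pi (e k) *~ c k = pi (\sum_k e k *~ c k).
  by rewrite raddf_sum; apply: eq_bigr => k _; rewrite raddfMz.
exists (fun k => pi (e k)); split=> [c | y].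
  by rewrite piE => /piP; rewrite degE => /rowP e0 k; have := e0 k; rewrite !mxE.
have [x ->] := piS y; exists (fun k => deg x 0 k); rewrite piE.
apply/eqP; rewrite -subr_eq0 -raddfB; apply/eqP/piP; rewrite raddfB degE.
by apply/rowP=> k; rewrite !mxE subrr.
Qed.

End FreeQuotient.

(** * Multiplicity of a prime in an element *)

Section Multiplicity.
Local Open Scope ring_scope.
Variable R : idomainType.
Implicit Types (p q a b u : R) (k l : nat).

Lemma prime_elt_exp p a k : prime_elt p -> rdivides p (a ^+ k) ->
  k != 0 /\ rdivides p a.
Proof.
move=> [p0 pN pM]; elim: k => [|k IHk].
  by rewrite expr0 => /rdivides_unit/(_ (unitr1 _)); rewrite (negPf pN).
by rewrite exprS => /pM[|/IHk[]].
Qed.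

Lemma rdivides_exp_cancel p a b k : prime_elt p -> ~ rdivides p a ->
  rdivides (p ^+ k) (a * b) -> rdivides (p ^+ k) b.
Proof.
move=> pP pa; have [p0 _ pM] := pP.
elim: k b => [|k IHk] b; first by move=> _; exists b; rewrite expr0 mulr1.
move=> [c cE]; have /pM[//|[b' bE]] : rdivides p (a * b).
  by rewrite cE exprS mulrCA; exists (c * p ^+ k); rewrite mulrC.
have /IHk[d b'E] : rdivides (p ^+ k) (a * b').
  by exists c; apply: (mulIf p0); rewrite -mulrA -bE cE exprSr mulrA.
by exists d; rewrite bE b'E exprSr mulrA.
Qed.

Definition has_mult p a k := rdivides (p ^+ k) a /\ ~ rdivides (p ^+ k.+1) a.

Lemma has_mult_uniq p a k l : has_mult p a k -> has_mult p a l -> k = l.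
Proof.
suff le k' l' : has_mult p a k' -> has_mult p a l' -> (k' <= l')%N.
  by move=> hk hl; apply/eqP; rewrite eqn_leq !le.
move=> [hk _] [_ hl]; rewrite leqNgt; apply/negP => lt_lk; apply: hl.
apply: rdivides_trans hk; exists (p ^+ (k' - l'.+1)).
by rewrite -exprD subnK.
Qed.

Lemma has_multM p a b k l : prime_elt p -> has_mult p a k -> has_mult p b l ->
  has_mult p (a * b) (k + l).
Proof.
move=> pP [[a' aE] ka] [[b' bE] lb]; have [p0 _ pM] := pP.
have abE : a * b = a' * b' * p ^+ (k + l) by rewrite aE bE exprD mulrACA.
split; first by exists (a' * b').
move=> [c]; rewrite abE exprS mulrA => /(mulIf (expf_neq0 _ p0)) e.
have /pM[[d dE]|[d dE]] : rdivides p (a' * b') by exists c.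
  by apply: ka; exists d; rewrite aE dE exprS mulrA.
by apply: lb; exists d; rewrite bE dE exprS mulrA.
Qed.

Lemma has_mult0 p a : ~ rdivides p a -> has_mult p a 0.
Proof. by move=> pa; split; [exists a; rewrite mulr1 | rewrite expr1]. Qed.

Lemma has_mult_prime p q : prime_elt p -> prime_elt q -> rdivides p q ->
  has_mult p q 1.
Proof.
move=> pP qP pq; split; rewrite ?expr1 // => -[c qE].
have [d pE] := prime_elt_dvd pP qP pq; have [p0 /negP pN _] := pP.
apply: pN; apply/unitrP; exists (d * c).
suff e : d * c * p = 1 by rewrite [p * _]mulrC e.
by apply: (mulIf p0); rewrite mul1r -!mulrA -expr2 -qE -pE.
Qed.

End Multiplicity.

(** * Weights on polynomial rings *)

Section Weights.
Local Open Scope ring_scope.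
Variables (K : fieldType) (n b : nat) (wt : 'I_n -> 'rV[int]_b).
Local Notation C := {mpoly K[n]}.
Implicit Types (f g h p : C) (m : 'X_{1..n}) (d e : 'rV[int]_b).

Definition mnmwt m : 'rV[int]_b := \sum_i wt i *+ m i.

Definition homog_of_wt d f := forall m, m \in msupp f -> mnmwt m = d.

(** Reading the weight off the leading monomial makes it total, and additive on products of nonzero
    polynomials. On nonzero homogeneous polynomials it is the degree. *)
Definition hwt f := mnmwt (mlead f).

Lemma mnmwtD m m' : mnmwt (m + m') = mnmwt m + mnmwt m'.
Proof. by rewrite -big_split; apply: eq_bigr => i _; rewrite mnmDE mulrnDr. Qed.

Lemma mnmwt0 : mnmwt 0 = 0.
Proof. by apply: big1 => i _; rewrite mnm0E mulr0n. Qed.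

Lemma hwtM f g : f != 0 -> g != 0 -> hwt (f * g) = hwt f + hwt g.
Proof. by move=> f0 g0; rewrite /hwt mleadM // mnmwtD. Qed.

Lemma hwt_homog d f : f != 0 -> homog_of_wt d f -> hwt f = d.
Proof. by move=> f0; apply; apply: mlead_supp. Qed.

Lemma homogM d e f g :
  homog_of_wt d f -> homog_of_wt e g -> homog_of_wt (d + e) (f * g).
Proof.
move=> fd ge m /msuppM_le/allpairsP[[m1 m2] /= [/fd m1d /ge m2e ->]].
by rewrite mnmwtD m1d m2e.
Qed.

Lemma homogX m : homog_of_wt (mnmwt m) 'X_[m].
Proof. by move=> m'; rewrite msuppX inE => /eqP->. Qed.

Lemma max_weight (T : eqType) (w : T -> int) (s : seq T) : s != [::] ->
  exists2 x, x \in s & forall y, y \in s -> (w y <= w x)%R.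
Proof.
elim: s => // x [|y s] IHs _.
  by exists x; rewrite ?mem_head // => z; rewrite inE => /eqP->.
have [//|z zs zmax] := IHs; have [le_xz|le_zx] := lerP (w x) (w z).
  by exists z => [|t]; rewrite inE ?zs ?orbT // => /orP[/eqP->//|/zmax].
exists x => [|t]; rewrite ?mem_head // inE => /orP[/eqP->//|/zmax le_tz].
exact: le_trans le_tz (ltW le_zx).
Qed.

Definition mpart (P : pred 'X_{1..n}) f := \sum_(m <- msupp f | P m) f@_m *: 'X_[m]
  : C.

Lemma mpart_split P f : f = mpart P f + mpart (predC P) f.
Proof. by rewrite {1}[f]mpolyE (bigID P). Qed.

Lemma msupp_mpart (P : pred 'X_{1..n}) f m : m \in msupp (mpart P f) -> m \in msupp
  f /\ P m.
Proof.
move=> /msupp_sum_le/flatten_mapP[m']; rewrite mem_filter => /andP[Pm' m'f].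
by move=> /msuppZ_le; rewrite msuppX inE => /eqP->.
Qed.

Lemma mcoeff_mpart (P : pred 'X_{1..n}) f m : P m -> (mpart P f)@_m = f@_m.
Proof.
move=> Pm; rewrite [in RHS](mpart_split P f) mcoeffD [X in _ + X]memN_msupp_eq0
  ?addr0 //.
by apply/negP => /msupp_mpart[_] /=; rewrite Pm.
Qed.

(* The product of the parts of top weight does not cancel, since [C] is a      *)
(* domain.                                                                     *)
Lemma top_weight (w : 'X_{1..n} -> int) f g :
    (forall m m', w (m + m')%MM = w m + w m') -> f * g != 0 ->
  exists m1 m2, [/\ m1 \in msupp f, m2 \in msupp g, (m1 + m2)%MM \in msupp (f * g),
    forall m, m \in msupp f -> w m <= w m1 & forall m, m \in msupp g -> w m <= w m2].
Proof.
move=> wD; rewrite mulf_eq0 negb_or -!msupp_eq0 => /andP[f0 g0].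
have [m1 m1f m1max] := max_weight w f0; have [m2 m2g m2max] := max_weight w g0.
pose P1 : pred 'X_{1..n} := fun m => w m == w m1.
pose P2 : pred 'X_{1..n} := fun m => w m == w m2.
have part0 (P : pred 'X_{1..n}) h m : P m -> m \in msupp h -> mpart P h != 0.
  by move=> Pm mh; apply: contraTneq mh => h0;
    rewrite mcoeff_msupp -(mcoeff_mpart h Pm) h0 mcoeff0 eqxx.
have F0 : mpart P1 f != 0 by apply: part0 m1f; rewrite /P1.
have G0 : mpart P2 g != 0 by apply: part0 m2g; rewrite /P2.
have [/msupp_mpart[m1'f /eqP wm1'] /msupp_mpart[m2'g /eqP wm2']] :=
  (mlead_supp F0, mlead_supp G0).
set m1' := mlead (mpart P1 f) in m1'f wm1' *;
  set m2' := mlead (mpart P2 g) in m2'g wm2' *.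
exists m1', m2'; rewrite wm1' wm2'; split=> //.
have low (F G : C) m (a c : int) : (forall m, m \in msupp F -> w m <= a) ->
    (forall m, m \in msupp G -> w m < c) -> w m = a + c -> (F * G)@_m = 0.
  move=> Fa Gc mE;
    apply/memN_msupp_eq0/negP=> /msuppM_le/allpairsP[[x y] /= [/Fa xa /Gc yc e]].
  by have := ler_ltD xa yc; rewrite -wD -e mE ltxx.
have low2 h (P : pred 'X_{1..n}) mm : (forall m, m \in msupp h -> w m <= w mm) -> P
  =1 (fun m => w m == w mm) ->
    forall m, m \in msupp (mpart (predC P) h) -> w m < w mm.
  by move=> hmax PE m /msupp_mpart[/hmax le /=]; rewrite PE lt_neqAle le andbT.
have wE : w (m1' + m2')%MM = w m1 + w m2 by rewrite wD wm1' wm2'.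
rewrite mcoeff_msupp [in f * g](mpart_split P2 g) mulrDr mcoeffD.
rewrite [X in _ + X](low _ _ _ _ _ m1max (low2 _ _ _ m2max (fun=> erefl))) // addr0.
rewrite [in f * _](mpart_split P1 f) mulrDl mcoeffD.
rewrite [_ * mpart P2 g in X in _ + X]mulrC.
rewrite [X in _ + X](low _ _ _ (w m2) (w m1) _ (low2 _ _ _ m1max (fun=> erefl)));
  last 2 first.
- by move=> m /msupp_mpart[/m2max].
- by rewrite wE addrC.
by rewrite addr0 -mleadM // mleadc_eq0 mulf_neq0.
Qed.

(** [top_weight] is applied to each coordinate of the weight and to its opposite. The extreme
    weights of [f * g] are sums of those of [f] and [g]; since they coincide for the product, they
    coincide for each factor. *)
Lemma homog_factorl d f g : f * g != 0 -> homog_of_wt d (f * g) ->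
  homog_of_wt (hwt f) f.
Proof.
move=> fg0 fgd m mf; apply/rowP=> k; pose w m := mnmwt m 0 k.
have wD m' m'' : w (m' + m'')%MM = w m' + w m'' by rewrite /w mnmwtD mxE.
have nwD m' m'' : - w (m' + m'')%MM = - w m' + - w m'' by rewrite wD opprD.
have [m1 [m2 [m1f m2g m12 le1 le2]]] := top_weight wD fg0.
have [n1 [n2 [n1f n2g n12 ge1 ge2]]] := top_weight nwD fg0.
have eqw : w m1 + w m2 = w n1 + w n2.
  by rewrite -!wD /w (fgd _ m12) (fgd _ n12).
have w1 : w m1 <= w n1 by rewrite -(lerD2r (w m2)) eqw lerD2l le2.
have wE x : x \in msupp f -> w x = w m1.
  move=> xf; apply/eqP; rewrite eq_le le1 //=; apply: le_trans w1 _.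
  by rewrite -lerN2 ge1.
rewrite -/(w m) wE // -(wE (mlead f)) // mlead_supp //.
by apply: contraNneq fg0 => ->; rewrite mul0r.
Qed.

Lemma hwt_unit u : u \is a GRing.unit -> hwt u = 0.
Proof.
by move=> /andP[/eqP -> _]; rewrite /hwt mleadC mnmwt0.
Qed.

Definition hprime p := prime_elt p /\ homog_of_wt (hwt p) p.

Lemma hprime_factors d f : f != 0 -> homog_of_wt d f ->
  exists u s, [/\ u \is a GRing.unit, forall p, p \in s -> hprime p
    & f = u * \prod_(p <- s) p].
Proof.
move=> f0 fd; have [u [s [uU sP fE]]] := factorial_mpoly f0.
exists u, s; split=> // p ps; split; first exact: sP.
have e : f = p * (u * \prod_(q <- rem p s) q).
  by rewrite fE (perm_big _ (perm_to_rem ps)) big_cons mulrCA.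
by rewrite e in f0 fd; apply: homog_factorl fd.
Qed.

Lemma prime_dvd_var p i j : prime_elt p -> rdivides p ('X_i : C) ->
  rdivides p ('X_j : C) -> i = j.
Proof.
move=> pP; have [p0 pN _] := pP.
have scale k : rdivides p ('X_k : C) -> exists2 c, c != 0 & 'X_k = c *: p.
  move=> [c cE]; have c0 : c != 0.
    by apply/negP => /eqP c0; have := msizeX K U_(k)%MM; rewrite cE c0 mul0r msize0.
  have := msizeX K U_(k)%MM; rewrite cE mdeg1 msizeM //.
  have : msize p != 1%N.
    apply: contra pN => /msize_poly1P[a a0 ->].
    by rewrite rmorph_unit // unitfE.
  have := p0; have := c0; rewrite -!msize_poly_eq0 => hc hp hp1 sz.
  have /msize_poly1P[a a0 aE] : msize c == 1%N.
    by move: hc hp hp1 sz; case: (msize c) => [|[|x]] //;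
      case: (msize p) => [|[|y]] //; rewrite addnC !addnS.
  by exists a; rewrite // -mul_mpolyC -aE.
move=> /scale[c c0 cE] /scale[d d0 dE].
have e : d *: ('X_i : C) = c *: 'X_j by rewrite cE dE !scalerA mulrC.
move/(congr1 (mcoeff U_(j)%MM)): e; rewrite !mcoeffZ !mcoeffXU eqxx mulr1.
by case: eqP => // _ /esym/eqP; rewrite mulr0 (negPf c0).
Qed.

Lemma prime_dvd_monomial p m : prime_elt p -> rdivides p ('X_[m] : C) ->
  exists2 i, m i != 0%N & rdivides p ('X_i : C).
Proof.
move=> pP; rewrite mpolyXE_id => /(prime_elt_prod pP)[i _].
by move=> /(prime_elt_exp pP)[]; exists i.
Qed.

(** Every degree is still attained when one variable is forbidden. As a prime divides at most one
    variable, this yields monomials of any degree not divisible by a given prime. The index [i0]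
    rules out [n = 0], where the condition would be vacuous. *)
Hypothesis wt_avoid : forall d i, exists m, mnmwt m = d /\ m i = 0%N.
Variable i0 : 'I_n.

Lemma avoiding_monomial p d : prime_elt p ->
  exists2 m, mnmwt m = d & ~ rdivides p ('X_[m] : C).
Proof.
move=> pP; have [[i pi]|npi] := pselect (exists i, rdivides p ('X_i : C)).
  have [m [md mi]] := wt_avoid d i; exists m => // /(prime_dvd_monomial pP)[j mj].
  by move=> /(prime_dvd_var pP pi) ij; rewrite -ij mi in mj.
have [m [md _]] := wt_avoid d i0; exists m => // /(prime_dvd_monomial pP)[j _ pj].
by apply: npi; exists j.
Qed.

End Weights.

(** * The class group of the degree zero part *)

Section GradedSubring.
Local Open Scope ring_scope.
Variables (K : fieldType) (n b : nat) (wt : 'I_n -> 'rV[int]_b).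
Local Notation C := {mpoly K[n]}.
Local Notation whomog := (homog_of_wt wt).
Variables (A : comNzRingType) (iota : {rmorphism A -> C}) (i0 : 'I_n).
Hypothesis iota_inj : injective iota.
Hypothesis iota_homog : forall a, whomog 0 (iota a).
Hypothesis iota_onto : forall f, whomog 0 f -> exists a, f = iota a.
Hypothesis wt_avoid : forall d i, exists m, mnmwt wt m = d /\ m i = 0%N.
Implicit Types (a c e : A) (f g p q : C) (Q : pred A) (D E : weil_divisor A).

Lemma iota_neq0 a : a != 0 -> iota a != 0.
Proof. by apply: contra_neq => e; apply: iota_inj; rewrite e rmorph0. Qed.

Lemma iota_wt a : a != 0 -> hwt wt (iota a) = 0.
Proof. by move=> a0; apply: hwt_homog (iota_neq0 a0) _. Qed.

Definition contraction p : pred A := fun a => `[< rdivides p (iota a) >].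

Lemma contractionP p a : reflect (rdivides p (iota a)) (a \in contraction p).
Proof. exact: asboolP. Qed.

Lemma contraction_prime p : prime_elt p -> is_prime_ideal (contraction p).
Proof.
move=> [p0 pN pM]; split; first split.
- by apply/contractionP; rewrite rmorph0; apply: rdivides0.
- apply/contractionP; rewrite rmorph1 => /rdivides_unit/(_ (unitr1 _)).
  by rewrite (negPf pN).
- move=> a x y /contractionP px /contractionP py; apply/contractionP.
  by rewrite rmorphD rmorphM; apply: rdividesD py; apply: rdivides_mull.
- move=> x y /contractionP; rewrite rmorphM => /pM[]px; apply/orP;
  by [left; apply/contractionP | right; apply/contractionP].
Qed.

Lemma contraction_sub p q :
  rdivides q p -> {subset contraction p <= contraction q}.
Proof.
by move=> qp a /contractionP pa; apply/contractionP; apply: rdivides_trans pa.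
Qed.

Lemma contraction_eq p q : rdivides p q -> rdivides q p ->
  contraction p = contraction q.
Proof.
move=> pq qp; apply/funext => a.
by apply/idP/idP; apply: (@contraction_sub _ _ _ a).
Qed.

(** The quotient in [C] is a factor of a homogeneous element, hence homogeneous, and by additivity
    its weight is 0. *)
Lemma iota_rdivides a c : a != 0 -> rdivides (iota a) (iota c) ->
  exists e, c = e * a.
Proof.
move=> a0 [g cE]; have ia0 := iota_neq0 a0.
have [->|c0] := eqVneq c 0; first by exists 0; rewrite mul0r.
have ic0 := iota_neq0 c0; have := @iota_homog c; have := iota_wt c0.
rewrite cE in ic0 *; have := ic0; rewrite mulf_eq0 negb_or => /andP[g0 _].
rewrite hwtM // iota_wt // addr0 => gwt /(homog_factorl ic0).
rewrite gwt => /iota_onto[e eE]; exists e; apply: iota_inj.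
by rewrite cE rmorphM eE.
Qed.

Lemma homogX_iota f m : whomog (- mnmwt wt m) f -> exists a, f * 'X_[m] = iota a.
Proof.
by move=> fm; apply: iota_onto; rewrite -(addNr (mnmwt wt m)); apply/homogM/homogX.
Qed.

(** A monomial of opposite weight moves [p] into [A]; because it avoids [q], the product lies in
    [contraction q] only if [q] divides [p]. *)
Lemma hprime_multiple p q : hprime wt p -> prime_elt q ->
  exists m a, [/\ p * 'X_[m] = iota a & ~ rdivides q ('X_[m] : C)].
Proof.
move=> [pP ph] qP; have [m mE qm] := avoiding_monomial wt_avoid i0 (- hwt wt p) qP.
have [|a aE] := @homogX_iota p m; first by rewrite mE opprK.
by exists m, a.
Qed.

Lemma contraction_le p q : hprime wt p -> hprime wt q ->
  {subset contraction p <= contraction q} -> rdivides q p.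
Proof.
move=> pP qP pq; have [m [a [aE qm]]] := hprime_multiple pP qP.1.
have /pq/contractionP : a \in contraction p.
  by apply/contractionP; rewrite -aE; apply: rdivides_mulr; apply: rdivides_refl.
by rewrite -aE; have [[_ _ qM] _] := qP => /qM[].
Qed.

Lemma contraction_neq0 p : hprime wt p -> exists2 a, a \in contraction p & a != 0.
Proof.
move=> pP; have [m [a [aE _]]] := hprime_multiple pP pP.1.
exists a; first by apply/contractionP; rewrite -aE; apply: rdivides_mulr;
  apply: rdivides_refl.
apply: contraTneq isT => a0; suff : p * 'X_[m] != 0 by rewrite aE a0 rmorph0 eqxx.
rewrite mulf_neq0 //; first exact: prime_elt_neq0 pP.1.
by rewrite -msize_poly_eq0 msizeX.
Qed.

(* If [iota a] is the product of the [p_i], the product of the contractions of *)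
(* the [p_i] lies in the ideal generated by [a].                               *)
Lemma prime_above_contraction Q : is_prime_ideal Q -> (exists2 a, a \in Q & a != 0) ->
  exists2 p, hprime wt p & {subset contraction p <= Q}.
Proof.
move=> [[Q0 Q1 QA] QM] [a aQ a0]; apply: contrapT => nQ.
have [u [s [uU sP aE]]] := hprime_factors (iota_neq0 a0) (@iota_homog a).
have [c cQ [d dE]] : exists2 c, c \notin Q & rdivides (\prod_(p <- s) p) (iota c).
  elim: s sP {aE} => [|p s IHs] sP.
    by exists 1; rewrite // big_nil rmorph1; apply: rdivides_refl.
  have [q qs|c cQ [d dE]] := IHs; first by apply: sP; rewrite inE qs orbT.
  have [c' /contractionP [d' d'E] c'Q] : exists2 c', c' \in contraction p & c'
    \notin Q.
    apply: contrapT => nc; apply: nQ; exists p; first by apply: sP; rewrite mem_head.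
    by move=> x xp; apply: contrapT => /negP xQ; apply: nc; exists x.
  exists (c' * c); first by apply/negP => /QM; rewrite (negPf c'Q) (negPf cQ).
  by exists (d' * d); rewrite rmorphM big_cons d'E dE mulrACA.
have [|e eE] := @iota_rdivides a c a0.
  by exists (d * u^-1); rewrite aE dE mulrA mulrVK.
by have := QA e a 0 aQ Q0; rewrite addr0 -eE (negPf cQ).
Qed.

Definition zero_ideal : pred A := fun a => a == 0.

Lemma zero_idealE a : (a \in zero_ideal) = (a == 0).
Proof. by []. Qed.

Lemma zero_prime : is_prime_ideal zero_ideal.
Proof.
split; first split; rewrite ?zero_idealE ?eqxx ?oner_eq0 //.
  by move=> a x y; rewrite !zero_idealE => /eqP-> /eqP->; rewrite mulr0 addr0.
move=> x y; rewrite !zero_idealE => /eqP xy; have := congr1 iota xy.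
rewrite rmorphM rmorph0 => /eqP; rewrite mulf_eq0.
by move=> /orP[]/eqP e; apply/orP; [left|right]; apply/eqP/iota_inj;
  rewrite e rmorph0.
Qed.

(** In a longer chain the member just below [contraction p] is nonzero, so it contains some
    [contraction q]. Then [p] divides [q], the two are associated, and that member is already all of
    [contraction p]. *)
Lemma contraction_height_one p : hprime wt p -> height_one (contraction p).
Proof.
move=> pP; apply/asboolP; split; first exact: contraction_prime pP.1.
  exists (fun i => if i == 0%N then zero_ideal else contraction p); split=> //.
  - by move=> [|i] _; [exact: zero_prime | exact: contraction_prime pP.1].
  - move=> [|//] _; split=> [x|]; first by rewrite zero_idealE => /eqP->;
    case: (contraction_prime pP.1) => -[].
    by have [x] := contraction_neq0 pP; exists x.
move=> [|[|k]] // [Q [Qpr Qlt Qp]].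
have [_ [x xQ xQ0]] := Qlt k (leqnSn _).
have x0 : x != 0.
  by apply: contraNneq xQ0 => ->;
    have [[]] := Qpr k (leq_trans (leqnSn _) (leqnSn _)).
have [q qP qQ] := prime_above_contraction (Qpr k.+1 (leqnSn _)) (ex_intro2 _ _ x xQ
  x0).
have [Qsub [y yQ]] := Qlt k.+1 (leqnn _); case/negP.
rewrite Qp in Qsub yQ.
have pq := contraction_le qP pP (fun z zq => Qsub z (qQ z zq)).
by apply: qQ; apply: contraction_sub yQ; apply: prime_elt_dvd pP.1 qP.1 pq.
Qed.

Lemma height_one_contraction P : height_one P ->
  exists2 p, hprime wt p & P = contraction p.
Proof.
move=> /asboolP[Ppr [Q [Qpr Qlt QP]] Pmax].
have P0 : exists2 a, a \in P & a != 0.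
  have [_ [x]] := Qlt 0%N isT; rewrite QP => xP xQ; exists x => //.
  by apply: contraNneq xQ => ->; have [[]] := Qpr 0%N isT.
have [p pP pQ] := prime_above_contraction Ppr P0; exists p => //.
apply/funext => x; apply/idP/idP; last exact: pQ.
move=> xP; apply: contrapT => /negP xp.
(* Otherwise the zero ideal, [contraction p] and [P] form a chain of length two. *)
suff /Pmax : prime_chain P 2 by [].
exists (fun i =>
  if i is i'.+1 then if i' is 0%N then contraction p else P else zero_ideal).
split=> //.
- by move=> [|[|i]] _; [exact: zero_prime | exact: contraction_prime pP.1 | ].
- move=> [|[|//]] _; split=> //.
  + by move=> y; rewrite zero_idealE => /eqP->; case: (contraction_prime pP.1) => -[].
  + by have [y] := contraction_neq0 pP; exists y.
  + by exists x.
Qed.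

Lemma rdivides_prod_pow p (r : seq A) : all (contraction p) r ->
  rdivides (p ^+ size r) (iota (\prod_(x <- r) x)).
Proof.
elim: r => [_|x r IHr] /=.
  by rewrite big_nil expr0 rmorph1; apply: rdivides_refl.
move=> /andP[/contractionP[c cE] /IHr[d dE]]; exists (c * d).
by rewrite big_cons rmorphM cE dE exprS mulrACA.
Qed.

Lemma in_local_powP p k a : hprime wt p ->
  in_local_pow (contraction p) k a <-> rdivides (p ^+ k) (iota a).
Proof.
move=> pP; split=> [[s sp [t [tp sE]]] | [f fE]].
  apply: (rdivides_exp_cancel (a := iota s) pP.1).
    by move=> ps; case/negP: sp; apply/contractionP.
  rewrite -rmorphM sE rmorph_sum big_seq; apply: rdivides_sum => ct ctt.
  rewrite rmorphM; apply: rdivides_mull.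
  by have := rdivides_prod_pow (tp _ ctt); rewrite size_tuple.
have [a0|a0] := eqVneq a 0.
  exists 1; last by exists [::]; split=> //; rewrite big_nil a0 mulr0.
  by have [[_]] := contraction_prime pP.1.
(* [m1] brings [p], and [m2] brings [f], into degree zero. Let [y], [c], [s] have images [p *
   'X_[m1]], [f * 'X_[m2]] and ['X_[m1] ^+ k * 'X_[m2]]; then [s] is outside the prime and
   [s * a = c * y ^+ k]. *)
have [m1 m1E pm1] := avoiding_monomial wt_avoid i0 (- hwt wt p) pP.1.
have [m2 m2E pm2] := avoiding_monomial wt_avoid i0 (hwt wt p *+ k) pP.1.
have p0 := prime_elt_neq0 pP.1; have pk0 := expf_neq0 k p0.
have ia0 := iota_neq0 a0; have := ia0; rewrite fE mulf_eq0 negb_or => /andP[f0 _].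
have hwt_pk : hwt wt (p ^+ k) = hwt wt p *+ k.
  elim: k {fE m2E pk0} => [|k IHk]; first by rewrite expr0 /hwt mlead1 mnmwt0.
  by rewrite exprS hwtM ?expf_neq0 // IHk mulrS.
have fwt : whomog (- mnmwt wt m2) f.
  have e : hwt wt f = - mnmwt wt m2.
    by apply/eqP; rewrite m2E -addr_eq0 -hwt_pk -hwtM // -fE iota_wt.
  by rewrite -e; apply: (@homog_factorl _ _ _ wt 0 f (p ^+ k)); rewrite -fE.
have [c cE] := homogX_iota fwt.
have [y yE] : exists y, p * 'X_[m1] = iota y.
  by apply: homogX_iota; rewrite m1E opprK; case: pP.
have [s sE] : exists s, 'X_[m1] ^+ k * 'X_[m2] = iota s.
  apply: iota_onto; rewrite mpolyXn -mpolyXD.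
  have <- : mnmwt wt (m1 *+ k + m2) = 0; last exact: homogX.
  have mnmwtMn l : mnmwt wt (m1 *+ l) = mnmwt wt m1 *+ l.
    by elim: l => [|l IHl]; rewrite ?mulm0n ?mnmwt0 // mulmS mnmwtD IHl mulrS.
  by rewrite mnmwtD mnmwtMn m1E m2E mulNrn addNr.
exists s.
  apply/contractionP; rewrite -sE; have [_ _ pM] := pP.1.
  by move=> /pM[/(prime_elt_exp pP.1)[]|].
exists [:: (c, [tuple of nseq k y])]; split=> [ct|].
  rewrite inE => /eqP->; apply/allP => x; rewrite mem_nseq => /andP[_ /eqP->].
  by apply/contractionP; rewrite -yE; apply: rdivides_mulr; apply: rdivides_refl.
apply: iota_inj; rewrite big_seq1 !rmorphM -sE fE -cE.
have -> : iota (\prod_(x <- nseq k y) x) = (p * 'X_[m1]) ^+ k.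
  by elim: (k) => [|l IHl];
    rewrite ?big_nil ?rmorph1 //= big_cons rmorphM IHl -yE exprS.
rewrite exprMn [p ^+ k * _]mulrC !mulrA; congr (_ * _).
by rewrite -mulrA mulrC [f * _]mulrC.
Qed.

Lemma ex_generator (P : prime_divisor A) :
  exists2 p, hprime wt p & val P = contraction p.
Proof. exact: height_one_contraction (valP P). Qed.

Definition gen P : C := s2val (cid2 (ex_generator P)).

Lemma gen_hprime P : hprime wt (gen P).
Proof. by rewrite /gen; case: cid2. Qed.

Lemma genE P : val P = contraction (gen P).
Proof. by rewrite /gen; case: cid2. Qed.

(** Extends [is_div] from [A] to [C], so that homogeneous elements of any degree have divisors. *)
Definition has_divisor f E := forall P : prime_divisor A,
  exists2 k, has_mult (gen P) f k & coeff P E = k%:Z.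

Lemma is_divE a E : is_div a E <-> has_divisor (iota a) E.
Proof.
have vE P k : has_valuation (val P) a k <-> has_mult (gen P) (iota a) k.
  rewrite genE /has_valuation /has_mult.
  by have lP l := @in_local_powP _ l a (gen_hprime P); rewrite !lP.
by split=> h P; have [k /vE hk ->] := h P; exists k.
Qed.

Lemma has_divisor_uniq f E E' : has_divisor f E -> has_divisor f E' -> E = E'.
Proof.
move=> hE hE'; apply/eqP/freeg_eqP => P; have [k hk ->] := hE P.
by have [k' /(has_mult_uniq hk) -> ->] := hE' P.
Qed.

Lemma has_divisorM f g E E' : has_divisor f E -> has_divisor g E' ->
  has_divisor (f * g) (E + E').
Proof.
move=> hE hE' P; have [k hk eE] := hE P; have [k' hk' eE'] := hE' P.
exists (k + k')%N; first by apply: has_multM => //; case: (gen_hprime P).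
by rewrite coeffD eE eE' PoszD.
Qed.

Lemma has_divisor_unit u : u \is a GRing.unit -> has_divisor u 0.
Proof.
move=> uU P; exists 0%N; last by rewrite coeff0.
apply: has_mult0 => /rdivides_unit/(_ uU).
by have [[_ /negP]] := gen_hprime P.
Qed.

Definition divisor_of p (pP : hprime wt p) : prime_divisor A :=
  Sub (contraction p) (contraction_height_one pP).

Lemma gen_divisor_of p (pP : hprime wt p) :
  rdivides (gen (divisor_of pP)) p /\ rdivides p (gen (divisor_of pP)).
Proof.
have e := genE (divisor_of pP); have gP := gen_hprime (divisor_of pP).
rewrite SubK in e.
by split; apply: contraction_le => // x; rewrite e.
Qed.

Lemma has_divisor_prime p (pP : hprime wt p) :
  has_divisor p << divisor_of pP >>.
Proof.
have [gp pg] := gen_divisor_of pP => P; rewrite coeffU mul1r.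
have [-> | ne] := eqVneq P (divisor_of pP).
  by exists 1%N => //; exact: has_mult_prime (gen_hprime _).1 pP.1 gp.
exists 0%N => //; apply: has_mult0 => gPp; case/eqP: ne.
apply: val_inj; rewrite genE SubK; apply: contraction_eq => //.
exact: prime_elt_dvd (gen_hprime _).1 pP.1 gPp.
Qed.

Definition divisor_wt (D : weil_divisor A) : 'rV[int]_b :=
  fglift (fun P => hwt wt (gen P)) D.

Lemma divisor_wt_is_additive : zmod_morphism divisor_wt.
Proof. exact: lift_is_additive. Qed.

HB.instance Definition _ := GRing.isZmodMorphism.Build
  (weil_divisor A) 'rV[int]_b divisor_wt divisor_wt_is_additive.

Lemma hwt_associated p q : prime_elt p -> rdivides p q -> rdivides q p ->
  hwt wt p = hwt wt q.
Proof.
move=> [p0 _ _] pq qp; have [u uU ->] := rdivides_antisym p0 pq qp.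
have u0 : u != 0 by apply: contraTneq uU => ->; rewrite unitr0.
by rewrite hwtM // (hwt_unit wt uU) add0r.
Qed.

Lemma ex_divisor f d : f != 0 -> whomog d f ->
  exists2 E, has_divisor f E & divisor_wt E = hwt wt f.
Proof.
move=> f0 fd; have [u [s [uU sP fE]]] := hprime_factors f0 fd.
rewrite fE; have u0 : u != 0 by apply: contraTneq uU => ->; rewrite unitr0.
elim: s sP {f0 fE} => [|p s IHs] sP.
  exists 0; rewrite big_nil mulr1; first exact: has_divisor_unit.
  by rewrite raddf0 hwt_unit.
have [|E hE wE] := IHs; first by move=> q qs; apply: sP; rewrite inE qs orbT.
have pP := sP p (mem_head _ _); have [gp pg] := gen_divisor_of pP.
exists (<< divisor_of pP >> + E).
  by rewrite big_cons mulrCA; apply: has_divisorM hE; apply: has_divisor_prime.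
have s0 : u * \prod_(q <- s) q != 0.
  rewrite mulf_neq0 // prodf_seq_neq0; apply/allP => q qs /=.
  by apply: prime_elt_neq0; have [] := sP q _; rewrite // inE qs orbT.
rewrite raddfD big_cons mulrCA hwtM ?(prime_elt_neq0 pP.1) //= wE; congr (_ + _).
rewrite /divisor_wt liftU scale1r; apply: hwt_associated => //.
by case: (gen_hprime (divisor_of pP)).
Qed.

Lemma divisor_wtE f d E : f != 0 -> whomog d f -> has_divisor f E ->
  divisor_wt E = hwt wt f.
Proof.
by move=> f0 fd hE; have [E' /(has_divisor_uniq hE)->] := ex_divisor f0 fd.
Qed.

Definition is_quotient_divisor D := exists f g E E', [/\ f != 0 /\ g != 0,
  whomog (hwt wt f) f /\ whomog (hwt wt g) g,
  has_divisor f E /\ has_divisor g E' & D = E - E'].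

Lemma is_quotient_divisor0 : is_quotient_divisor 0.
Proof.
exists 1, 1, 0, 0; rewrite subr0 oner_eq0; split=> //.
  by split=> m; rewrite msupp1 inE => /eqP->; rewrite /hwt mlead1.
by have := has_divisor_unit (unitr1 C).
Qed.

Lemma is_quotient_divisorB D1 D2 : is_quotient_divisor D1 ->
  is_quotient_divisor D2 -> is_quotient_divisor (D1 - D2).
Proof.
move=> [f1 [g1 [E1 [E1' [[f10 g10] [f1h g1h] [f1d g1d] ->]]]]].
move=> [f2 [g2 [E2 [E2' [[f20 g20] [f2h g2h] [f2d g2d] ->]]]]].
exists (f1 * g2), (g1 * f2), (E1 + E2'), (E1' + E2).
split; first by rewrite !mulf_neq0.
- by rewrite !hwtM //; split; apply: homogM.
- by split; apply: has_divisorM.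
- by rewrite opprB addrACA opprD.
Qed.

(** A prime divisor is the divisor of its generator, and differences of divisors of homogeneous
    elements form a group. *)
Lemma ex_quotient D : is_quotient_divisor D.
Proof.
have N D1 : is_quotient_divisor D1 -> is_quotient_divisor (- D1).
  by rewrite -[- D1]add0r; apply: is_quotient_divisorB is_quotient_divisor0.
have d D1 D2 : is_quotient_divisor D1 -> is_quotient_divisor D2 ->
    is_quotient_divisor (D1 + D2).
  by move=> h1 h2; rewrite -[D2]opprK; apply: is_quotient_divisorB h1 (N _ h2).
rewrite -(freeg_sumE D); apply: big_ind => // [|P _];
  first exact: is_quotient_divisor0.
have [pP eP] : exists pP : hprime wt (gen P), divisor_of pP = P.
  by exists (gen_hprime P); apply: val_inj; rewrite SubK -genE.
have hP : is_quotient_divisor << P >>.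
  exists (gen P), 1, << P >>, 0; rewrite subr0 oner_eq0 (prime_elt_neq0 pP.1).
  split=> //; last by rewrite -{2}eP; split;
    [apply: has_divisor_prime | apply: has_divisor_unit (unitr1 C)].
  by split; [exact: pP.2 | move=> m; rewrite msupp1 inE => /eqP->;
    rewrite /hwt mlead1].
have -> : << coeff P D *g P >> = << P >> *~ coeff P D.
  by rewrite freegU_mulz intz.
have hPn k : is_quotient_divisor (<< P >> *+ k).
  by elim: k => [|k IHk]; [exact: is_quotient_divisor0 | rewrite mulrS; apply: d].
by case: (coeff P D) => k; rewrite ?NegzE ?mulrNz -?pmulrn;
  [exact: hPn | apply/N/hPn].
Qed.

Lemma principalP D : D \in @principal A <-> divisor_wt D = 0.
Proof.
split=> [/asboolP[s [sP ->]]|].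
  rewrite raddf_sum big_seq big1 // => cE /sP[a a0 /is_divE aE].
  by rewrite raddfMz /= (divisor_wtE (iota_neq0 a0) (@iota_homog a) aE) ?iota_wt //
    mul0rz.
have [f [g [E [E' [[f0 g0] [fh gh] [fE gE] ->]]]]] := ex_quotient D.
rewrite raddfB /= (divisor_wtE f0 fh fE) (divisor_wtE g0 gh gE) => /eqP.
rewrite subr_eq0 => /eqP fgwt.
(* The homogeneous elements [f] and [g] have the same weight; a common monomial factor of opposite
   weight brings both into [A] and cancels in the difference. *)
have [m [mE _]] := wt_avoid (- hwt wt f) i0.
have Xm0 : 'X_[m] != 0 :> C by rewrite -msize_poly_eq0 msizeX.
have [M hM _] := ex_divisor Xm0 (@homogX _ _ _ wt m).
have [a aE] : exists a, f * 'X_[m] = iota a by apply: homogX_iota; rewrite mE opprK.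
have [c cE] : exists c, g * 'X_[m] = iota c.
  by apply: homogX_iota; rewrite mE opprK fgwt.
apply/asboolP; exists [:: (1, E + M); (-1, E' + M)]; split.
  have nz h x : h != 0 -> h * 'X_[m] = iota x -> x != 0.
    move=> h0 e; apply: contraNneq (mulf_neq0 h0 Xm0).
    by rewrite e => ->; rewrite rmorph0.
  move=> cD; rewrite !inE => /orP[]/eqP->.
    by exists a; [exact: nz aE | apply/is_divE; rewrite -aE; apply: has_divisorM].
  by exists c; [exact: nz cE | apply/is_divE; rewrite -cE; apply: has_divisorM].
by rewrite big_cons big_seq1 /= mulrNz mulr1z opprD addrACA subrr addr0.
Qed.

Theorem Cl_graded_subring : free_of_rank (Cl A) b.
Proof.
pose I := GRing.ZmodClosed.clone (weil_divisor A) (@principal A) _.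
have piP D : \pi_(Quotient.quot I)%qT D = 0 <-> divisor_wt D = 0.
  rewrite -principalP -(raddf0 \pi_(Quotient.quot I)%qT).
  have := Quotient.idealrBE I D 0; rewrite subr0 => ->; split=> [->|/eqP//].
  by [].
apply: (@quotient_free_of_rank (weil_divisor A) (Cl A) b \pi_(Quotient.quot I)%qT
  divisor_wt).
- move=> y; exists (repr (y : Quotient.quot I)).
  exact: (esym (reprK (y : Quotient.quot I))).
- exact: piP.
move=> k; have [m [mE _]] := wt_avoid (delta_mx 0 k) i0.
have Xm0 : 'X_[m] != 0 :> C by rewrite -msize_poly_eq0 msizeX.
have [E _ EE] := ex_divisor Xm0 (@homogX _ _ _ wt m).
by exists E; rewrite /= EE /hwt mleadXm.
Qed.

End GradedSubring.

(** * Monomial primes of a graph ring *)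

Section Facets.
Variables (N : nat) (G : simple_graph N).
Local Notation T := ('I_N * {set 'I_N})%type.
Implicit Types (x y : T) (i j k l : 'I_N) (e : {set 'I_N}).
Implicit Types (M : 'I_N -> 'I_N -> nat) (u : T -> nat).

Definition nbr k := [set j | G k j].

(* If e is a set of neighbours of k, (k, e) stands for the prime generated by   *)
(* x_kk, the x_kj with j in e, and the x_jk with j a neighbour outside e. If k  *)
(* and j are distinct and not adjacent, (k, [set j]) stands for the prime       *)
(* generated by the free variable x_kj.                                         *)
Definition facet : pred T := fun x : T => (x.2 \subset nbr x.1)
  || [exists j : 'I_N, [&& j != x.1, ~~ G x.1 j & x.2 == [set j]]].

(* The valuation along x of the monomial with exponents M.                      *)
Definition facet_exp M (x : T) : nat := if x.2 \subset nbr x.1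
  then M x.1 x.1 + \sum_(j in nbr x.1) (if j \in x.2 then M x.1 j else M j x.1)
  else \sum_(j in x.2) M x.1 j.

(* The relations div(x_ii) = 0, div(x_ij) = 0 express the classes of the other  *)
(* monomial primes by those of the basic ones.                                  *)
Definition basic : {set T} := [set x : T | (x.2 \subset nbr x.1)
  && ((1 < #|x.2|) || [exists j : 'I_N, (x.1 < j) && (x.2 == [set j])])].

Definition slope (v : T -> int) k j : int := (v (k, [set j]) - v (k, set0))%R.

(* The coordinates of a degree; they vanish on the valuations of a monomial of  *)
(* R_G because its exponents M satisfy v (k, e) - v (k, set0) =                 *)
(* \sum_(j in e) (M k j - M j k).                                               *)
Definition basic_deg (v : T -> int) (x : T) : int := if 1 < #|x.2|
  then (v x - v (x.1, set0) - \sum_(j in x.2) slope v x.1 j)%R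
  else (\sum_(j in x.2) (slope v x.1 j + slope v j x.1))%R.

(* The exponents of the monomial with valuations u that is not divisible by     *)
(* x_ij x_ji for any edge ij; the subtractions are truncated.                   *)
Definition normal_exp u i j := if i == j
  then u (i, set0) - \sum_(k in nbr i) (u (i, set0) - u (i, [set k]))
  else if G i j then u (i, [set j]) - u (i, set0) else u (i, [set j]).

Lemma in_nbr k j : (j \in nbr k) = G k j.
Proof. by rewrite inE. Qed.

Lemma nbr_neq k j : G k j -> (j == k) = false.
Proof. by move=> kj; apply/negbTE; apply: contraTneq kj => ->; rewrite adj_irr. Qed.

Lemma facet0 k : facet (k, set0).
Proof. by rewrite /facet /= sub0set. Qed.

Lemma facet1 k j : G k j -> facet (k, [set j]).
Proof. by rewrite /facet /= sub1set in_nbr /= => ->. Qed.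

Lemma facet_exp0 M k :
  facet_exp M (k, set0) = M k k + \sum_(j in nbr k) M j k.
Proof.
rewrite /facet_exp /= sub0set; congr (_ + _); by apply: eq_bigr => j _; rewrite inE.
Qed.

Lemma facet_exp1 M k j : G k j ->
  facet_exp M (k, [set j]) + M j k = facet_exp M (k, set0) + M k j.
Proof.
move=> kj; rewrite facet_exp0 /facet_exp /= sub1set in_nbr /= kj.
rewrite (bigD1 j) ?in_nbr //= [in RHS](bigD1 j) ?in_nbr //= in_set1 eqxx.
rewrite (eq_bigr (fun l => M l k)) => [|l /andP[_ /negbTE lj]]; first by lia.
by rewrite in_set1 lj.
Qed.

Lemma slope_facet_exp M k j : G k j ->
  slope (fun x => Posz (facet_exp M x)) k j = ((M k j)%:Z - (M j k)%:Z)%R.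
Proof. by move=> /facet_exp1 => /(_ M); rewrite /slope; lia. Qed.

Lemma Posz_sum (I : Type) (r : seq I) (P : pred I) (F : I -> nat) :
  ((\sum_(i <- r | P i) F i)%N%:Z = \sum_(i <- r | P i) (F i)%:Z)%R.
Proof. exact: (big_morph Posz PoszD (erefl _)). Qed.

Lemma sum_sub_nbr k e (f : 'I_N -> int) : e \subset nbr k ->
  (\sum_(j in e) f j = \sum_(j in nbr k) if j \in e then f j else 0)%R.
Proof.
move=> /subsetP ek; rewrite -big_mkcondr; apply: eq_bigl => j.
by case je: (j \in e); rewrite ?andbF // ek.
Qed.

Lemma facet_exp_sub M k e : e \subset nbr k ->
  ((facet_exp M (k, e))%:Z = (facet_exp M (k, set0))%:Z +
    \sum_(j in e) ((M k j)%:Z - (M j k)%:Z))%R.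
Proof.
move=> ek; rewrite facet_exp0 /facet_exp ek /= !PoszD -addrA; congr (_ + _)%R.
rewrite !Posz_sum (sum_sub_nbr _ ek) -big_split; apply: eq_bigr => j _ /=.
by case: ifP => _; lia.
Qed.

Lemma basic_deg_facet_exp M x : x \in basic ->
  basic_deg (fun y => Posz (facet_exp M y)) x = 0%R.
Proof.
case: x => k e; rewrite inE /basic_deg /= => /andP[ek _].
have adj j : j \in e -> G k j by move=> je; rewrite -in_nbr (subsetP ek).
case: ifP => _.
  rewrite (facet_exp_sub M ek) [X in (X - _)%R]addrAC addrN add0r -sumrB big1 // =>
    j je.
  by rewrite slope_facet_exp ?adj // subrr.
rewrite big1 // => j je; rewrite !slope_facet_exp ?adj // 1?adj_sym ?adj //.
by lia.
Qed.

Lemma basic_pair k j : G k j -> k < j -> (k, [set j]) \in basic.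
Proof.
move=> kj lt_kj; rewrite inE /= sub1set in_nbr /= kj.
by apply/orP; right; apply/existsP; exists j; rewrite lt_kj /=.
Qed.

Section DegreeZero.
Variable u : T -> nat.
Let v x : int := u x.
Hypothesis u0 : forall x, x \in basic -> basic_deg v x = 0%R.

Lemma slope_opp k j : G k j -> (slope v k j + slope v j k)%R = 0%R.
Proof.
have lt k' j' : G k' j' -> k' < j' -> (slope v k' j' + slope v j' k')%R = 0%R.
  move=> kj lt_kj; have := u0 (basic_pair kj lt_kj).
  by rewrite /basic_deg /= cards1 /= big_set1.
move=> kj; case: (ltngtP k j) => [|jk|/val_inj e]; first exact: lt.
  by rewrite addrC lt // adj_sym.
by move: kj; rewrite e adj_irr.
Qed.

Lemma degree0_sum k e : e \subset nbr k ->
  (v (k, e) = v (k, set0) + \sum_(j in e) slope v k j)%R.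
Proof.
move=> ek; have [lt_1e|] := ltnP 1 #|e|.
  have /u0 : (k, e) \in basic by rewrite inE /= ek lt_1e.
  by rewrite /basic_deg /= lt_1e; lia.
case ce: #|e| => [|[|//]] _.
  by move/cards0_eq: ce => ->; rewrite big_set0 addr0.
by move/eqP/cards1P: ce => [j ->]; rewrite big_set1 /slope addrC subrK.
Qed.

(** Surjectivity onto degree zero, on exponents: the positive parts of the slopes at [k] become the
    exponents of the x_kj, and the exponent of x_kk takes up the rest. *)
Lemma facet_exp_normal x : facet x -> facet_exp (normal_exp u) x = u x.
Proof.
case: x => k e; rewrite /facet_exp /facet /=; case: ifP => [ek _|_ /=].
  have adj j : j \in e -> G k j by move=> je; rewrite -in_nbr (subsetP ek).
  (* [lo] collects the neighbours of negative slope. Since [u (k, lo)] is a natural number, the sum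
     subtracted in the diagonal exponent is at most [u (k, set0)], so truncation loses nothing. *)
  pose lo := [set j in nbr k | u (k, [set j]) < u (k, set0)].
  have lok : lo \subset nbr k by apply/subsetP => j; rewrite inE => /andP[].
  have le_lo : \sum_(j in nbr k) (u (k, set0) - u (k, [set j])) <= u (k, set0).
    have := degree0_sum lok; rewrite (sum_sub_nbr _ lok).
    have -> : (\sum_(j in nbr k) (if j \in lo then slope v k j else 0) =
        - (\sum_(j in nbr k) (u (k, set0) - u (k, [set j])))%N%:Z)%R.
      rewrite Posz_sum -sumrN; apply: eq_bigr => j jk.
      by rewrite inE jk /slope /v /=; case: ifP; lia.
    by rewrite /v; lia.
  apply/eqP; rewrite -eqz_nat PoszD; apply/eqP.
  rewrite -[RHS]/(v (k, e)) (degree0_sum ek) /normal_exp eqxx.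
  rewrite -subzn // Posz_sum -addrA /v; congr (_ + _)%R.
  rewrite (sum_sub_nbr _ ek) Posz_sum -sumrN -big_split; apply: eq_bigr => j.
  rewrite in_nbr => kj; have jk : G j k by rewrite adj_sym.
  rewrite kj jk (nbr_neq kj) (nbr_neq jk) /=.
  by have := slope_opp kj; rewrite /slope /v; case: (j \in e); lia.
move=> /existsP[j /and3P[jk /negbTE kj /eqP ->]].
by rewrite big_set1 /normal_exp eq_sym (negbTE jk) kj.
Qed.

End DegreeZero.

(** The right-hand side is the effect of replacing x_ij x_ji by x_ii x_jj as often as possible: each
    edge moves the minimum of its two exponents to both diagonal entries. *)
Lemma normal_exp_facet_exp M i j : normal_exp (facet_exp M) i j =
  if i == j then M i i + \sum_(k in nbr i) minn (M i k) (M k i)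
  else if G i j then M i j - M j i else M i j.
Proof.
rewrite /normal_exp; case: ifP => [_|ij].
  have -> : \sum_(k in nbr i) (facet_exp M (i, set0) - facet_exp M (i, [set k])) =
      \sum_(k in nbr i) (M k i - M i k).
    by apply: eq_bigr => k; rewrite in_nbr => /(facet_exp1 M); lia.
  rewrite facet_exp0.
  have -> : \sum_(k in nbr i) M k i =
      \sum_(k in nbr i) (M k i - M i k) + \sum_(k in nbr i) minn (M i k) (M k i).
    by rewrite -big_split; apply: eq_bigr => k _ /=; lia.
  by lia.
case: ifP => [/(facet_exp1 M)|nij]; first by lia.
by rewrite /facet_exp /= sub1set in_nbr /= nij big_set1.
Qed.

Lemma ex_unit_facet x : facet x -> exists M, facet_exp M x = 1.
Proof.
case: x => k e; rewrite /facet /=; have [ek _|ek /=] := boolP (e \subset nbr k).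
  exists (fun i j => (i == k) && (j == k)); rewrite /facet_exp ek /= !eqxx.
  rewrite big1 // => j; rewrite in_nbr => kj.
  by rewrite (nbr_neq kj) !andbF !andFb if_same.
move=> /existsP[j /and3P[_ _ /eqP ee]].
exists (fun i l => (i == k) && (l == j)); rewrite /facet_exp /= (negbTE ek) ee.
by rewrite big_set1 !eqxx.
Qed.

(* The exponents of a monomial in the relative interior of the facet [x].       *)
Lemma ex_interior_facet x : facet x ->
  exists M, facet_exp M x = 0 /\ forall y, facet y -> y != x -> 0 < facet_exp M y.
Proof.
case: x => k e; rewrite {1}/facet /=; have [ek _|ek /=] := boolP (e \subset nbr k).
  (* The product of the variables outside the prime, apart from the edge variables not involving
     [k]: a neighbour [j] of [k] contributes x_jk if it is in [e], and x_kj otherwise. *)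
  exists (fun i j => if i == j then i != k else if G i j then
    (if i == k then j \notin e else (j == k) && (i \in e)) else true).
  split=> [|[k' e']].
    rewrite /facet_exp ek /= !eqxx big1 // => j; rewrite in_nbr => kj.
    have jk : G j k by rewrite adj_sym.
    rewrite (nbr_neq kj) (nbr_neq jk) kj jk.
    by case: (j \in e).
  rewrite /facet /facet_exp /=; case: ifP => [e'k' _|_ /=]; last first.
    move=> /existsP[j /and3P[jk' /negbTE k'j /eqP->]] _.
    by rewrite big_set1 eq_sym (negbTE jk') k'j.
  rewrite xpair_eqE /= eqxx; have [kk /= ee|//] := eqVneq k' k;
    rewrite {}kk in e'k' *.
  have [j je] : exists j, (j \in e) != (j \in e').
    apply/existsP; rewrite -negb_forall; apply: contra ee => /forallP h.
    by apply/eqP/setP => j; move/(_ j)/eqP: h.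
  have kj : G k j.
    rewrite -in_nbr; move: je (subsetP ek j) (subsetP e'k' j).
    by case: (j \in e); case: (j \in e') => //= _ h1 h2; [apply: h1 | apply: h2].
  have jk : G j k by rewrite adj_sym.
  rewrite (bigD1 j) ?in_nbr //= (nbr_neq kj) (nbr_neq jk) kj jk /=.
  by move: je; case: (j \in e); case: (j \in e').
move=> /existsP[j /and3P[jk /negbTE kj /eqP ee]].
(* The product of all diagonal variables and of all free variables except x_kj. *)
exists (fun i l =>
  if i == l then true else if G i l then false else (i, l) != (k, j)).
split=> [|[k' e']].
  by rewrite /facet_exp /= (negbTE ek) ee big_set1 eq_sym (negbTE jk) kj eqxx.
rewrite /facet /facet_exp /=; case: ifP => [e'k' _|_ /=]; first by rewrite eqxx.
move=> /existsP[l /and3P[lk' /negbTE k'l /eqP->]];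
  rewrite big_set1 [k' == l]eq_sym (negbTE lk') k'l.
by rewrite ee !xpair_eqE lt0b; apply: contraNN => /andP[-> /eqP->]; rewrite eqxx.
Qed.

Lemma eq_basic_deg (v w : T -> int) x : x \in basic -> (forall y, facet y -> v y =
  w y) ->
  basic_deg v x = basic_deg w x.
Proof.
case: x => k e; rewrite inE /= => /andP[/subsetP ek _] vw; rewrite /basic_deg /=.
have adj j : j \in e -> G k j by move=> /ek; rewrite in_nbr.
have slopeE k' j : G k' j -> slope v k' j = slope w k' j.
  by move=> kj; rewrite /slope !vw ?facet0 ?facet1.
rewrite !vw ?facet0 //; last by rewrite /facet /=; apply/orP; left; apply/subsetP.
case: ifP => _.
  by congr (_ - _)%R; apply: eq_bigr => j /adj; apply: slopeE.
by apply: eq_bigr => j /adj kj; rewrite !slopeE // adj_sym.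
Qed.

Lemma basic_degD (v w : T -> int) x :
  basic_deg (fun y => v y + w y)%R x = (basic_deg v x + basic_deg w x)%R.
Proof.
have slopeD k j : slope (fun y => v y + w y)%R k j = (slope v k j + slope w k j)%R.
  by rewrite /slope opprD addrACA.
rewrite /basic_deg; case: ifP => _.
  under eq_bigr do rewrite slopeD.
  by rewrite big_split /= !opprD [(v x + w x + _)%R]addrACA [LHS]addrACA.
rewrite -big_split /=; apply: eq_bigr => j _; by rewrite !slopeD addrACA.
Qed.

Lemma basic_degMz (v : T -> int) (c : int) x :
  basic_deg (fun y => c * v y)%R x = (c * basic_deg v x)%R.
Proof.
have slopeM k j : slope (fun y => c * v y)%R k j = (c * slope v k j)%R.
  by rewrite /slope mulrBr.
rewrite /basic_deg; case: ifP => _.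
  under eq_bigr do rewrite slopeM.
  by rewrite -mulr_sumr !mulrBr.
by rewrite mulr_sumr; apply: eq_bigr => j _; rewrite !slopeM [RHS]mulrDr.
Qed.

Lemma basic_deg_onto (d : T -> int) :
  exists v, forall x, x \in basic -> basic_deg v x = d x.
Proof.
pose D x : int := if x \in basic then d x else 0%R.
have D0 k : D (k, set0) = 0%R.
  rewrite /D inE cards0 /=; case: existsP => [[j /andP[_ /eqP e]]|];
    last by rewrite andbF.
  by have := set11 j; rewrite -e inE.
(* For this witness [v (k, set0) = 0] and the slope at [k] towards [j] is [D (k, [set j])]. As [D]
   vanishes off [basic], at most one of the two slopes along an edge is nonzero. *)
exists (fun x =>
  if (1 < #|x.2|)%N then (D x + \sum_(j in x.2) D (x.1, [set j]))%R else D x).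
move=> [k e] xB; rewrite /basic_deg /slope /= !cards0 /= !D0.
have DE : D (k, e) = d (k, e) by rewrite /D xB.
have [lt_1e|le_e1] := ltnP 1 #|e|.
  rewrite [X in (_ - X)%R](eq_bigr (fun j => D (k, [set j]))) => [|j _];
    last by rewrite cards1 subr0.
  by rewrite DE subr0 addrK.
move: xB DE;
  rewrite inE /= ltnNge le_e1 /= => /andP[ek /existsP[j /andP[kj /eqP ->]]] <-.
rewrite big_set1 !cards1 /= D0 !subr0 [D (j, _)]/D.
case: ifP; last by rewrite addr0.
rewrite inE /= cards1 /= => /andP[_ /existsP[l /andP[jl /eqP /set1_inj e']]].
by move: kj jl; rewrite e'; lia.
Qed.

(* Correct an integral solution by monomials of degree zero: first make the     *)
(* exponent at [z] vanish, then make the others nonnegative.                    *)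
Lemma ex_avoiding_exponent (d : T -> int) z : facet z -> exists u,
  u z = 0 /\ forall x, x \in basic -> basic_deg (fun y => Posz (u y)) x = d x.
Proof.
move=> zF; have [v vd] := basic_deg_onto d.
have [M1 M1z] := ex_unit_facet zF; have [M2 [M2z M2pos]] := ex_interior_facet zF.
pose w y : int := (v y + - v z * Posz (facet_exp M1 y))%R.
pose c := (\sum_(y : T) `|w y|%N)%N.
pose t y : int := (w y + Posz c * Posz (facet_exp M2 y))%R.
have t_ge0 y : facet y -> (0 <= t y)%R.
  move=> yF; have [->|yz] := eqVneq y z; first by rewrite /t /w M1z M2z; lia.
  have : (`|w y| <= c)%N by rewrite /c (bigD1 y) //= leq_addr.
  by have := M2pos y yF yz; rewrite /t; nia.
exists (fun y => `|t y|%N); split; first by rewrite /t /w M1z M2z; lia.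
move=> x xB; rewrite -(vd x xB).
rewrite (@eq_basic_deg _ t) // => [|y yF]; last by have := t_ge0 y yF; lia.
rewrite basic_degD basic_degMz basic_degD basic_degMz !basic_deg_facet_exp //.
by rewrite !mulr0 !addr0.
Qed.

End Facets.

(** * The Cox ring of a graph ring *)

Section CoxEmbedding.
Local Open Scope ring_scope.
Variables (K : fieldType) (N : nat) (G : simple_graph N).
Local Notation S := {mpoly K[N * N]}.
Local Notation T := ('I_N * {set 'I_N})%type.
Local Notation nF := #|facet G|.
Local Notation nB := #|basic G|.
Local Notation C := {mpoly K[nF]}.
Local Notation A := (graph_ring K G).
Implicit Types (m : 'X_{1..N * N}) (u : T -> nat) (M : 'I_N -> 'I_N -> nat).

Definition facet_mnm u : 'X_{1..nF} := [multinom u (enum_val i) | i < nF].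

(** The sum makes this total on pairs, with value 0 outside [facet], and linear in [c]. *)
Definition facet_coef (c : 'X_{1..nF}) (x : T) : nat :=
  (\sum_(i | enum_val i == x) c i)%N.

Lemma facet_coefE c i : facet_coef c (enum_val i) = c i.
Proof.
rewrite /facet_coef (big_pred1 i) // => j.
by rewrite /= (inj_eq enum_val_inj).
Qed.

Lemma facet_mnmK c : facet_mnm (facet_coef c) = c.
Proof. by apply/mnmP => i; rewrite mnmE facet_coefE. Qed.

Lemma facet_coefK u x : facet G x -> facet_coef (facet_mnm u) x = u x.
Proof.
move=> xF; rewrite -(enum_rankK_in xF xF) facet_coefE mnmE.
by rewrite (enum_rankK_in xF xF).
Qed.

Lemma eq_facet_mnm u u' : (forall x, facet G x -> u x = u' x) ->
  facet_mnm u = facet_mnm u'.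
Proof.
by move=> e; apply/mnmP => i; rewrite !mnmE e //; have := enum_valP i.
Qed.

Definition facet_wt (i : 'I_nF) : 'rV[int]_nB :=
  \row_c basic_deg (fun x => (enum_val i == x)%:Z) (enum_val c).

Lemma facet_wtE c : mnmwt facet_wt c =
  \row_k basic_deg (fun x => (facet_coef c x)%:Z) (enum_val k).
Proof.
apply/rowP => k; rewrite /mnmwt summxE mxE.
have -> : (fun x => (facet_coef c x)%:Z) =
    (fun x => \sum_i (c i)%:Z * (enum_val i == x)%:Z).
  apply/funext => x; rewrite /facet_coef Posz_sum big_mkcond.
  by apply: eq_bigr => i _; case: eqP => _; rewrite ?mulr1 ?mulr0.
elim: (index_enum _) => [|i r IHr].
  have -> : (fun x : T => \sum_(i <- [::]) (c i)%:Z * (enum_val i == x)%:Z) =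
      (fun x => 0 * (0 : int)).
    by apply/funext => x; rewrite big_nil mulr0.
  by rewrite basic_degMz mul0r big_nil.
have -> : (fun x : T => \sum_(i <- i :: r) (c i)%:Z * (enum_val i == x)%:Z) =
    (fun x => (c i)%:Z * (enum_val i == x)%:Z + \sum_(i <- r) (c i)%:Z * (enum_val
      i == x)%:Z).
  by apply/funext => x; rewrite big_cons.
by rewrite basic_degD basic_degMz big_cons IHr mulmxnE mxE -mulr_natl natz.
Qed.

Lemma facet_wt_avoid d i : exists c, mnmwt facet_wt c = d /\ c i = 0%N.
Proof.
pose dT x : int := \sum_(k | enum_val k == x) d 0 k.
have [u [uz ud]] := ex_avoiding_exponent dT (enum_valP i).
exists (facet_mnm u); rewrite mnmE uz facet_wtE; split=> //.
apply/rowP => k; rewrite mxE -(@eq_basic_deg _ G (fun x => (u x)%:Z)) ?enum_valP //.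
  rewrite ud ?enum_valP // /dT (big_pred1 k) // => l.
  by rewrite /= (inj_eq enum_val_inj).
by move=> x xF; rewrite facet_coefK.
Qed.

Definition mnm_matrix m i j := m (mxvec_index i j).

Definition matrix_mnm M : 'X_{1..N * N} :=
  (\sum_(p : 'I_N * 'I_N) U_(mxvec_index p.1 p.2) *+ M p.1 p.2)%MM.

Lemma mxvec_index_inj (i j i' j' : 'I_N) :
  (mxvec_index i j == mxvec_index i' j') = ((i, j) == (i', j')).
Proof.
apply/eqP/eqP => [|[-> ->] //].
by move=> /cast_ord_inj/enum_rank_inj.
Qed.

Lemma matrix_mnmK M : mnm_matrix (matrix_mnm M) =2 M.
Proof.
move=> i j; rewrite /mnm_matrix /matrix_mnm mnm_sumE (bigD1 (i, j)) //=.
rewrite mulmnE mnm1E eqxx mul1n big1 ?addn0 // => -[i' j'] ne.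
by rewrite mulmnE mnm1E mxvec_index_inj (negbTE ne).
Qed.

Lemma mnm_matrixK m : matrix_mnm (mnm_matrix m) = m.
Proof.
apply/mnmP => k; case/mxvec_indexP: k => i j.
exact: matrix_mnmK.
Qed.

Definition cox_exp m := facet_mnm (facet_exp G (mnm_matrix m)).

Lemma cox_expD m m' : cox_exp (m + m') = (cox_exp m + cox_exp m')%MM.
Proof.
apply/mnmP => i; rewrite mnmDE !mnmE /facet_exp /mnm_matrix; case: ifP => _.
  rewrite mnmDE addnACA -big_split; congr (_ + _)%N; apply: eq_bigr => j _ /=.
  by case: ifP => _; rewrite mnmDE.
by rewrite -big_split; apply: eq_bigr => j _ /=; rewrite mnmDE.
Qed.

Lemma cox_exp0 : cox_exp 0 = 0%MM.
Proof.
have := cox_expD 0 0; rewrite addm0 => e; apply: (@addmI _ (cox_exp 0)).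
by rewrite -e addm0.
Qed.

Definition cox_map : S -> C := mmap (@mpolyC _ K) (fun i => 'X_[cox_exp U_(i)]).

HB.instance Definition _ := GRing.RMorphism.copy cox_map
  (mmap (@mpolyC nF K) (fun i => 'X_[cox_exp U_(i)])).

Lemma mmap1_cox m : mmap1 (fun i => 'X_[cox_exp U_(i)]) m = 'X_[cox_exp m] :> C.
Proof.
rewrite /mmap1 (eq_bigr (fun i => 'X_[cox_exp U_(i) *+ m i])) => [|i _];
  last by rewrite mpolyXn.
rewrite mprodXE; congr 'X_[_]; rewrite [in RHS](multinomUE_id m).
rewrite (big_morph cox_exp cox_expD cox_exp0); apply: eq_bigr => i _.
by elim: (m i) => [|k IHk]; rewrite ?mulm0n ?cox_exp0 // !mulmS cox_expD IHk.
Qed.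

Lemma cox_mapX m : cox_map 'X_[m] = 'X_[cox_exp m].
Proof. by rewrite /cox_map mmapX mmap1_cox. Qed.

Lemma cox_mapE f : cox_map f = \sum_(m <- msupp f) f@_m *: 'X_[cox_exp m].
Proof. by apply: eq_bigr => m _; rewrite mmap1_cox mul_mpolyC. Qed.

(** Along [(k, e)] with [e] a set of neighbours, both monomials have valuation
    [(i == k) + (j == k)], since exactly one of x_kl, x_lk lies in the prime for each neighbour [l].
    Along a free variable both have valuation 0. *)
Lemma facet_exp_edge i j x : G i j -> facet G x ->
  facet_exp G (mnm_matrix (U_(mxvec_index i i) + U_(mxvec_index j j))) x =
  facet_exp G (mnm_matrix (U_(mxvec_index i j) + U_(mxvec_index j i))) x.
Proof.
move=> ij; case: x => k e.
have ji : G j i by rewrite adj_sym.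
have diag l l' : mnm_matrix (U_(mxvec_index i i) + U_(mxvec_index j j)) l l' =
    ((i == l) && (i == l') + (j == l) && (j == l'))%N.
  by rewrite /mnm_matrix mnmDE !mnm1E !mxvec_index_inj !xpair_eqE.
have off l l' : mnm_matrix (U_(mxvec_index i j) + U_(mxvec_index j i)) l l' =
    ((i == l) && (j == l') + (j == l) && (i == l'))%N.
  by rewrite /mnm_matrix mnmDE !mnm1E !mxvec_index_inj !xpair_eqE.
have ne a c : a != c -> forall d : 'I_N, ((d == a) && (d == c))%N = false.
  by move=> ac d; case: eqVneq => //= ->; apply/negbTE.
rewrite /facet /facet_exp /=; case: ifP => [ek _|_ /=]; last first.
  move=> /existsP[l /and3P[lk nkl /eqP->]]; rewrite !big_set1 diag off.
  have kl : k != l by rewrite eq_sym.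
  rewrite !(ne _ _ kl); have -> : (i == k) && (j == l) = false.
    by apply: contraNF nkl => /andP[/eqP<- /eqP<-].
  suff -> : (j == k) && (i == l) = false by [].
  by apply: contraNF nkl => /andP[/eqP<- /eqP<-].
have sum1 a c : G a c -> (\sum_(l in nbr G k) ((a == k) && (c == l)) = (a == k))%N.
  move=> ac; case: eqVneq => [ak|_] /=; last by rewrite big1.
  rewrite (bigD1 c) /=; last by rewrite in_nbr -ak.
  by rewrite eqxx big1 // => l /andP[_]; rewrite eq_sym => /negbTE->.
have ijN : i != j by rewrite eq_sym (nbr_neq ij).
have neL a c : a != c -> forall d : 'I_N, ((a == d) && (c == d))%N = false.
  by move=> ac d; rewrite ![_ == d]eq_sym ne.
rewrite diag off !andbb big1 ?addn0 => [|l]; last first.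
  rewrite in_nbr => /nbr_neq kl; have kl' : k != l by rewrite eq_sym kl.
  by rewrite !diag !(ne _ _ kl') ![(_ == l) && _]andbC !(ne _ _ kl') if_same.
rewrite (eq_bigr (fun l => (i == k) && (j == l) + (j == k) && (i == l))%N);
  last first.
  by move=> l _; rewrite !off; case: ifP => // _; rewrite addnC ![(_ == l) && _]andbC.
by rewrite big_split /= !sum1 // !neL // eq_sym.
Qed.

Lemma cox_map_ideal f : graph_ideal G f -> cox_map f = 0.
Proof.
move=> /asboolP[c ->]; rewrite raddf_sum big1 // => -[i j] /= /andP[_ ij].
rewrite rmorphM [X in _ * X](_ : _ = 0) ?mulr0 // /edge_binomial /xvar /=.
rewrite rmorphB !rmorphM /= !cox_mapX -!mpolyXD -!cox_expD.
apply/eqP; rewrite subr_eq0; apply/eqP; congr 'X_[_].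
by apply: eq_facet_mnm => x; apply: facet_exp_edge.
Qed.

Local Notation I := (Idealr.clone S (graph_ideal G) _).

Definition graph_pi : {rmorphism S -> A} :=
  GRing.RMorphism.clone _ _ (\pi_(Quotient.quot I)%qT : S -> A) _.

Lemma graph_pi_onto (a : A) : exists f, a = graph_pi f.
Proof.
exists (repr (a : Quotient.quot I)); exact: (esym (reprK (a : Quotient.quot I))).
Qed.

Lemma graph_pi_eq f g : graph_pi f = graph_pi g <-> graph_ideal G (f - g).
Proof.
rewrite -[graph_ideal G (f - g)]/(f - g \in I) Quotient.idealrBE.
by split=> [e|/eqP //]; apply/eqP.
Qed.

Definition cox_embedding (a : A) : C := cox_map (repr (a : Quotient.quot I)).

Lemma cox_embedding_pi f : cox_embedding (graph_pi f) = cox_map f.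
Proof.
apply/eqP; rewrite -subr_eq0 -rmorphB; apply/eqP/cox_map_ideal/graph_pi_eq.
exact: (reprK (graph_pi f : Quotient.quot I)).
Qed.

Lemma cox_embedding_is_zmod_morphism : zmod_morphism cox_embedding.
Proof.
move=> a b; have [f ->] := graph_pi_onto a; have [g ->] := graph_pi_onto b.
by rewrite -rmorphB !cox_embedding_pi rmorphB.
Qed.

Lemma cox_embedding_is_monoid_morphism : monoid_morphism cox_embedding.
Proof.
split; first by rewrite -(rmorph1 graph_pi) cox_embedding_pi rmorph1.
move=> a b; have [f ->] := graph_pi_onto a; have [g ->] := graph_pi_onto b.
by rewrite -rmorphM !cox_embedding_pi rmorphM.
Qed.

HB.instance Definition _ := GRing.isZmodMorphism.Build A C cox_embedding
  cox_embedding_is_zmod_morphism.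
HB.instance Definition _ := GRing.isMonoidMorphism.Build A C cox_embedding
  cox_embedding_is_monoid_morphism.

Lemma cox_exp_wt m : mnmwt facet_wt (cox_exp m) = 0.
Proof.
rewrite facet_wtE; apply/rowP => k; rewrite !mxE.
rewrite -(@eq_basic_deg _ G (fun x =>
  (facet_exp G (mnm_matrix m) x)%:Z)) ?enum_valP //.
  by rewrite basic_deg_facet_exp ?enum_valP.
by move=> x xF; rewrite facet_coefK.
Qed.

Lemma cox_embedding_homog a : homog_of_wt facet_wt 0 (cox_embedding a).
Proof.
have [f ->] := graph_pi_onto a; rewrite cox_embedding_pi cox_mapE => c.
move=> /msupp_sum_le/flatten_mapP[m _ /msuppZ_le].
by rewrite msuppX inE => /eqP->; apply: cox_exp_wt.
Qed.

Definition normal_mnm (c : 'X_{1..nF}) := matrix_mnm (normal_exp G (facet_coef c)).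

Lemma cox_exp_normal c : mnmwt facet_wt c = 0 -> cox_exp (normal_mnm c) = c.
Proof.
move=> c0; rewrite -[RHS]facet_mnmK; apply: eq_facet_mnm => x xF.
have u0 y : y \in basic G -> basic_deg (fun x => (facet_coef c x)%:Z) y = 0.
  move=> yB; have := facet_wtE c; rewrite c0 => /rowP/(_ (enum_rank_in yB y)).
  by rewrite !mxE (enum_rankK_in yB yB).
rewrite -(facet_exp_normal u0 xF); congr (facet_exp G _ x).
by apply/funext => i; apply/funext => j; rewrite matrix_mnmK.
Qed.

Lemma cox_embedding_onto f : homog_of_wt facet_wt 0 f ->
  exists a, f = cox_embedding a.
Proof.
move=> f0; exists (graph_pi (\sum_(c <- msupp f) f@_c *: 'X_[normal_mnm c])).
rewrite cox_embedding_pi raddf_sum {1}[f]mpolyE big_seq [RHS]big_seq.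
apply: eq_bigr => c cf; rewrite /= -!mul_mpolyC rmorphM /= cox_mapX /cox_map mmapC.
by rewrite cox_exp_normal // f0.
Qed.

Local Notation gx i j := (graph_pi (xvar K i j)).

Lemma graph_piX_edge i j : G i j -> gx i j * gx j i = gx i i * gx j j.
Proof.
have lt i' j' : G i' j' -> (i' < j')%N -> gx i' j' * gx j' i' = gx i' i' * gx j' j'.
  move=> ij lt_ij; apply/esym; rewrite -!rmorphM; apply/graph_pi_eq/asboolP.
  exists (fun p => (p == (i', j'))%:R);
    rewrite (bigD1 (i', j')) ?lt_ij //= eqxx mul1r.
  by rewrite big1 ?addr0 // => p /andP[_ /negbTE ->]; rewrite mul0r.
move=> ij; case: (ltngtP i j) => [|ji|/val_inj e]; first exact: lt.
  by rewrite mulrC lt 1?mulrC // adj_sym.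
by move: ij; rewrite e adj_irr.
Qed.

Lemma prod_offdiag (F : 'I_N * 'I_N -> A) : (forall i, F (i, i) = 1) ->
  \prod_p F p = \prod_(p : 'I_N * 'I_N | (p.1 < p.2)%N) (F p * F (p.2, p.1)).
Proof.
move=> F1; rewrite (bigID (fun p : 'I_N * 'I_N => p.1 < p.2)%N) /= big_split;
  congr (_ * _).
rewrite [LHS](bigID (fun p : 'I_N * 'I_N =>
  p.2 < p.1)%N) /= [X in _ * X = _]big1 => [|[i j]] /=; last first.
  by case: (ltngtP i j) => // e; rewrite (val_inj e).
rewrite mulr1 (reindex_inj (h := fun p => (p.2, p.1))) /=;
  last by move=> [a c] [a' c'] [-> ->].
by apply: eq_big => [[i j]|//] /=; case: (ltngtP i j).
Qed.

(** Pairing [(i, j)] with [(j, i)] turns each factor into a power of an edge relation. *)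
Lemma prod_edges (nu : 'I_N -> 'I_N -> nat) :
    (forall i j, nu i j = nu j i) -> (forall i j, ~~ G i j -> nu i j = 0%N) ->
  \prod_(p : 'I_N * 'I_N) gx p.1 p.2 ^+ nu p.1 p.2 =
  \prod_(p : 'I_N * 'I_N) gx p.1 p.1 ^+ nu p.1 p.2.
Proof.
move=> nuC nu0; have nu1 i : nu i i = 0%N by rewrite nu0 // adj_irr.
rewrite [LHS]prod_offdiag => [|i]; last by rewrite /= nu1.
rewrite [RHS]prod_offdiag => [|i]; last by rewrite /= nu1.
apply: eq_bigr => -[i j] _ /=; have [ij|/nu0 nij] := boolP (G i j).
  by rewrite [nu j i]nuC -!exprMn_comm ?graph_piX_edge //; apply: mulrC.
by rewrite [nu j i]nuC nij !expr0.
Qed.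

Lemma graph_pi_monomial M :
  graph_pi 'X_[matrix_mnm M] = \prod_(p : 'I_N * 'I_N) gx p.1 p.2 ^+ M p.1 p.2.
Proof.
rewrite /matrix_mnm -mprodXE rmorph_prod; apply: eq_bigr => p _.
by rewrite -mpolyXn rmorphXn.
Qed.

Lemma graph_pi_normal m :
  graph_pi 'X_[normal_mnm (cox_exp m)] = graph_pi 'X_[m].
Proof.
set M := mnm_matrix m; rewrite -[m in RHS]mnm_matrixK -/M !graph_pi_monomial.
have nE i j : normal_exp G (facet_coef (cox_exp m)) i j = normal_exp G (facet_exp G
  M) i j.
  rewrite /normal_exp /cox_exp facet_coefK ?facet0 //; case: eqP => [_|/eqP ij].
    by congr (_ - _)%N; apply: eq_bigr => k; rewrite in_nbr => ik;
      rewrite facet_coefK ?facet1.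
  rewrite facet_coefK // /facet /= sub1set in_nbr; case: (boolP (G i j)) => //= nij.
  by apply/existsP; exists j; rewrite eq_sym ij nij /=.
(* [nu] is the part of the exponents made of full products x_ij x_ji over edges; [prod_edges] moves
   it to the diagonal, while [mu] stays in place. *)
pose nu i j := if G i j then minn (M i j) (M j i) else 0%N.
pose mu i j := (M i j - nu i j)%N.
have nu1 i : nu i i = 0%N by rewrite /nu adj_irr.
have -> : \prod_(p : 'I_N * 'I_N) gx p.1 p.2 ^+ normal_exp G (facet_coef (cox_exp
  m)) p.1 p.2 =
  \prod_(p : 'I_N * 'I_N) gx p.1 p.2 ^+ mu p.1 p.2 *
  \prod_(p : 'I_N * 'I_N) gx p.1 p.2 ^+ (if p.1 == p.2 then \sum_j nu p.1 j else 0)%N.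
  rewrite -big_split; apply: eq_bigr => -[i j] _ /=;
    rewrite -exprD nE normal_exp_facet_exp.
  congr (_ ^+ _); rewrite /mu; case: eqP => [<-|_].
    rewrite nu1 subn0; congr (_ + _)%N; rewrite big_mkcond; apply: eq_bigr => k _.
    by rewrite in_nbr.
  by rewrite /nu addn0; case: ifP => _; lia.
have -> : \prod_(p : 'I_N * 'I_N) gx p.1 p.2 ^+ M p.1 p.2 =
  \prod_(p : 'I_N * 'I_N) gx p.1 p.2 ^+ mu p.1 p.2 *
  \prod_(p : 'I_N * 'I_N) gx p.1 p.2 ^+ nu p.1 p.2.
  rewrite -big_split; apply: eq_bigr => -[i j] _ /=; rewrite -exprD; congr (_ ^+ _).
  by rewrite /mu /nu; case: ifP => _; lia.
congr (_ * _); rewrite prod_edges => [||i j].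
- rewrite -(pair_bigA _ (fun i j =>
  gx i j ^+ (if i == j then \sum_j nu i j else 0)%N)) /=.
  rewrite -(pair_bigA _ (fun i j => gx i i ^+ nu i j)) /=.
  apply: eq_bigr => i _; set s := (\sum_j nu i j)%N;
    rewrite [LHS](bigD1 i) //= eqxx big1 => [|j]; last first.
    by rewrite eq_sym => /negbTE ->.
  by rewrite mulr1 /s expr_sum.
- by move=> i j; rewrite /nu adj_sym minnC.
- by rewrite /nu => /negbTE ->.
Qed.

(** By [graph_pi_normal] the class of a monomial depends only on its [cox_exp]. When the terms of
    [f] are grouped by this value [c], the class [H c] gets the coefficient of ['X_[c]] in
    [cox_map f], which is 0. *)
Lemma cox_map_ker f : cox_map f = 0 -> graph_pi f = 0.
Proof.
move=> f0; have coef0 c : \sum_(m <- msupp f) f@_m * (cox_exp m == c)%:R = 0.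
  rewrite -[RHS](mcoeff0 _ c) -f0 cox_mapE raddf_sum; apply: eq_bigr => m _.
  by rewrite /= mcoeffZ mcoeffX.
pose s := undup [seq cox_exp m | m <- msupp f].
pose H c := graph_pi 'X_[normal_mnm c].
have -> : graph_pi f = \sum_(m <- msupp f) \sum_(c <- s)
    graph_pi (f@_m * (cox_exp m == c)%:R)%:MP * H c.
  rewrite {1}[f]mpolyE raddf_sum big_seq [RHS]big_seq; apply: eq_bigr => m mf.
  have ms : cox_exp m \in s by rewrite mem_undup map_f.
  rewrite (bigD1_seq _ ms (undup_uniq _)) /= eqxx mulr1 big1 => [|c]; last first.
    by rewrite eq_sym => /negbTE ->; rewrite mulr0 mpolyC0 rmorph0 mul0r.
  by rewrite addr0 /H graph_pi_normal -rmorphM mul_mpolyC.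
rewrite exchange_big big1 // => c _.
by rewrite -mulr_suml -!raddf_sum /= coef0 mpolyC0 rmorph0 mul0r.
Qed.

Lemma cox_embedding_inj : injective cox_embedding.
Proof.
apply/raddf_inj => a; have [f ->] := graph_pi_onto a.
by rewrite /= cox_embedding_pi; apply: cox_map_ker.
Qed.

Theorem Cl_graph_ring : (0 < N)%N -> free_of_rank (Cl A) nB.
Proof.
move=> N0; have i0 : 'I_nF := enum_rank_in (facet0 G (Ordinal N0)) (Ordinal N0, set0).
exact: (Cl_graded_subring (iota := cox_embedding) i0 cox_embedding_inj
  cox_embedding_homog cox_embedding_onto facet_wt_avoid).
Qed.

End CoxEmbedding.

(** * Ranks *)

Section Rank.
Local Open Scope ring_scope.

(** Rank over the rationals gives a nonzero row in the left kernel; [D] clears its denominators. *)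
Lemma int_relation n' n (c : 'I_n' -> 'I_n -> int) : (n < n')%N ->
  exists2 a : 'I_n' -> int, exists j, a j != 0 & forall i, \sum_j a j * c j i = 0.
Proof.
move=> lt_n; pose P : 'M[rat]_(n', n) := \matrix_(j, i) (c j i)%:~R.
have /rowV0Pn[r /sub_kermxP rP r0] : kermx P != 0.
  by rewrite -mxrank_eq0 mxrank_ker subn_eq0 -ltnNge (leq_ltn_trans (rank_leq_col P)).
have [j rj] : exists j, r 0 j != 0.
  apply/existsP; apply: contraNT r0; rewrite negb_exists => /forallP h.
  by apply/eqP/rowP => j; rewrite mxE; apply/eqP; have := h j; rewrite negbK.
pose D : int := \prod_j denq (r 0 j).
have D0 : D%:~R != 0 :> rat.
  by rewrite intr_eq0; apply/prodf_neq0 => l _; exact: denq_neq0.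
pose a l : int := numq (r 0 l) * \prod_(l' | l' != l) denq (r 0 l').
have aE l : (a l)%:~R = r 0 l * D%:~R.
  rewrite -[r 0 l in RHS]divq_num_den /D (bigD1 l) //= !rmorphM /= mulrA divfK //.
  by rewrite intr_eq0 denq_neq0.
exists a; first by exists j; rewrite -(intr_eq0 rat) aE mulf_neq0.
move=> i; apply/eqP; rewrite -(intr_eq0 rat) rmorph_sum /=; apply/eqP.
transitivity ((r *m P) 0 i * D%:~R); last by rewrite rP mxE mul0r.
by rewrite mxE mulr_suml; apply: eq_bigr => l _; rewrite rmorphM /= aE mxE mulrAC.
Qed.

Lemma free_of_rank_has_rank (M : zmodType) n : free_of_rank M n -> has_rank M n.
Proof.
move=> [v [vI vS]]; split; first by exists v.
move=> n' v' v'I; rewrite leqNgt; apply/negP => lt_n.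
have /choice[c cE] : forall j, exists c : 'I_n -> int, v' j = \sum_i v i *~ c i.
  by move=> j; apply: vS.
have [a [j /negP aj] ac] := int_relation c lt_n; apply: aj; apply/eqP/v'I.
rewrite (eq_bigr (fun j => \sum_i v i *~ (a j * c j i))); last first.
  by move=> l _; rewrite cE mulrz_suml; apply: eq_bigr => i _; rewrite mulrC mulrzA.
rewrite exchange_big big1 // => i _.
by rewrite -mulrz_sumr ac mulr0z.
Qed.

End Rank.

(** * Counting the basic classes *)

Section CardBasic.
Variables (N : nat) (G : simple_graph N).

(** An edge gives one basic singleton, attached to its smaller end. Both sides are doubled so that
    edges are counted by the sum of the degrees. *)
Lemma card_basic : (#|basic G|).*2 =
  (\sum_k #|[set e : {set 'I_N} | (e \subset nbr G k) && (1 < #|e|)]|).*2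
  + \sum_k #|nbr G k|.
Proof.
have -> : \sum_k #|nbr G k| = (\sum_k #|[set j in nbr G k | k < j]|).*2.
  have sumE (F : 'I_N -> 'I_N -> bool) : \sum_k #|[set j | F k j]| = \sum_k \sum_j
    F k j.
    by apply: eq_bigr => k _; rewrite cardsE -sum1_card big_mkcond.
  rewrite /nbr [in RHS](eq_bigr (fun k => #|[set j | G k j && (k < j)]|)); last first.
    by move=> k _; apply: eq_card => j; rewrite !inE.
  rewrite !sumE -addnn [X in _ = _ + X]exchange_big -big_split; apply: eq_bigr => k _.
  rewrite -big_split; apply: eq_bigr => j _ /=; rewrite [G j k]adj_sym.
  case: (ltngtP k j) => [||/val_inj->]; rewrite ?andbT ?andbF ?addn0 ?add0n //.
  by rewrite adj_irr.
rewrite -doubleD -big_split /=; congr _.*2.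
have -> : #|basic G| = \sum_k \sum_e ((k, e) \in basic G).
  by rewrite pair_bigA -sum1_card big_mkcond; apply: eq_bigr => -[k e] _ /=;
    case: ifP.
apply: eq_bigr => k _; set B := [set e | _]; set S := [set j in nbr G k | _].
have -> : \sum_e ((k, e) \in basic G) = #|B :|: [set [set j] | j in S]|.
  rewrite -sum1_card [RHS]big_mkcond; apply: eq_bigr => e _.
  rewrite !inE /=; case: (boolP (e \subset nbr G k)) => /= ek; last first.
    case: imsetP => // -[j jS ee]; case/negP: ek.
    by move: jS; rewrite ee sub1set inE => /andP[].
  case: ltnP => //= _; congr nat_of_bool;
    apply/existsP/imsetP => [[j /andP[kj /eqP ee]]|[j]].
    by exists j; rewrite // inE kj andbT -sub1set -ee.
  by rewrite inE => /andP[_ kj] ->; exists j; rewrite kj /=.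
rewrite cardsU (_ : B :&: _ = set0) ?cards0 ?subn0 ?card_imset //;
  first exact: set1_inj.
apply/setP => e; rewrite !inE;
  apply/negbTE/negP => /andP[/andP[_ lt_1e] /imsetP[j _ ee]].
by move: lt_1e; rewrite ee cards1.
Qed.

Lemma card_basic1 : (forall k, #|nbr G k| = 1) -> (#|basic G|).*2 = N.
Proof.
move=> G1; rewrite card_basic [X in X.*2]big1 => [|k _].
  by rewrite (eq_bigr _ (fun k _ => G1 k)) sum_nat_const card_ord muln1.
apply/eqP; rewrite cards_eq0; apply/eqP/setP => e; rewrite !inE.
by apply/negbTE/negP => /andP[/subset_leq_card]; rewrite G1; lia.
Qed.

(** Each vertex contributes its whole neighbourhood as the only subset with two elements, and there
    are [N] edges. *)
Lemma card_basic2 : (forall k, #|nbr G k| = 2) -> #|basic G| = 2 * N.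
Proof.
move=> G2; apply: double_inj; rewrite card_basic.
rewrite (eq_bigr (fun=> 1)) => [|k _]; last first.
  rewrite (_ : [set e | _] = [set nbr G k]) ?cards1 //; apply/setP => e; rewrite !inE.
  apply/andP/eqP => [[ek lt_1e]|->]; last by rewrite G2.
  by apply/eqP; rewrite eqEcard ek G2.
by rewrite (eq_bigr _ (fun k _ => G2 k)) !sum_nat_const card_ord; lia.
Qed.

End CardBasic.

(** * Cycles and perfect matchings *)

Section Examples.

Lemma cycle_order N (G : simple_graph N) m : is_cycle G m -> N = m.
Proof. by move=> [f /bij_eq_card]; rewrite !card_ord. Qed.

Lemma cycle_degree N (G : simple_graph N) m : 2 < m -> is_cycle G m ->
  forall k, #|nbr G k| = 2.
Proof.
move=> m3 [f [g fK gK] fE] k; rewrite -(gK k); set i := g k.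
have -> : nbr G (f i) = f @: [set ordS i; ord_pred i].
  apply/setP => l; rewrite -(gK l) in_nbr fE (mem_imset _ _ (can_inj fK)) !inE.
  by congr (_ || _); rewrite -[RHS](inj_eq (can_inj (@ordSK m))) ord_predK eq_sym.
rewrite (card_imset _ (can_inj fK)) cards2 (_ : ordS i != ord_pred i) //.
(* Equality would mean [i + 2 = i] modulo [m], impossible for [m > 2]; the wrap-around cases
   [i = m - 1] and [i = m - 2] are treated apart. *)
apply/eqP => /(congr1 (@ordS m)); rewrite ord_predK => /(congr1 val) /=.
have := ltn_ord i; rewrite leq_eqVlt => /orP[/eqP mE|lt1].
  by rewrite mE modnn modn_small; lia.
rewrite (modn_small lt1); move: lt1; rewrite leq_eqVlt => /orP[/eqP mE|lt2].
  by rewrite mE modnn; lia.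
by rewrite (modn_small lt2); lia.
Qed.

Definition opposite n (i : 'I_(n + n)) : 'I_(n + n) :=
  match split i with inl a => rshift n a | inr a => lshift n a end.

Lemma opposite_lshift n (a : 'I_n) : opposite (lshift n a) = rshift n a.
Proof. by rewrite /opposite -[lshift n a]/(unsplit (inl a)) unsplitK. Qed.

Lemma opposite_rshift n (a : 'I_n) : opposite (rshift n a) = lshift n a.
Proof. by rewrite /opposite -[rshift n a]/(unsplit (inr a)) unsplitK. Qed.

Lemma oppositeK n : involutive (@opposite n).
Proof.
by move=> i; case: (split_ordP i) => a ->;
  rewrite !(opposite_lshift, opposite_rshift).
Qed.

Definition matching_adj n : rel 'I_(n + n) := fun i j => j == opposite i.

Lemma matching_sym n : ssrbool.symmetric (@matching_adj n).
Proof.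
by move=> i j;
  rewrite /matching_adj -(inj_eq (inv_inj (@oppositeK n))) oppositeK eq_sym.
Qed.

Lemma matching_irr n : irreflexive (@matching_adj n).
Proof.
move=> i; apply/negbTE; rewrite /matching_adj.
case: (split_ordP i) => a ->; rewrite ?opposite_lshift ?opposite_rshift -val_eqE /=;
  by have := ltn_ord a; lia.
Qed.

Definition matching n := SimpleGraph (@matching_sym n) (@matching_irr n).

Lemma matching_degree n k : #|nbr (matching n) k| = 1.
Proof. by rewrite -(cards1 (opposite k)); apply: eq_card => j; rewrite !inE. Qed.

End Examples.

Theorem mainTheorem6 (K : fieldType) :
  (forall (m N : nat) (G : simple_graph N),
     3 <= m -> is_cycle G m -> has_rank (Cl (graph_ring K G)) (2 * m))
  /\
  (forall n : nat, 0 < n ->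
     exists (N : nat) (G : simple_graph N),
       free_of_rank (Cl (graph_ring K G)) n).
Proof.
split=> [m N G m3 Gm | n n0].
  rewrite -(cycle_order Gm) -(card_basic2 (cycle_degree m3 Gm)).
  apply/free_of_rank_has_rank/Cl_graph_ring.
  by rewrite (cycle_order Gm) (leq_trans _ m3).
exists (n + n), (matching n).
have e : #|basic (matching n)| = n.
  by apply: double_inj; rewrite (card_basic1 (@matching_degree n)) addnn.
by rewrite -[X in free_of_rank _ X]e; apply: Cl_graph_ring; rewrite addn_gt0 n0.
Qed.
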